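(* Let $1<m<\infty$ and let $(M^n,g,u^{2-m-n}\,\mathrm{dvol}_g)$ be a compact quasi-Einstein smooth metric measure space (with dimensional parameter $2-m-n$), with quasi-Einstein constant $\mu>0$ and characteristic constant $\lambda$. Then, at every point of $M$, $$|\nabla u|^2+\frac{\lambda}{m+n-1}<\frac{\mu}{m-1}u^2.$$
   Context: For finite $k\neq0$, a smooth metric measure space with dimensional parameter $k$ is a four-tuple $(M^n,g,w^k\,\mathrm{dvol}_g,k)$ of a (connected, boundaryless) Riemannian manifold, a positive function $w\in C^\infty(M)$ and $k\in\mathbb{R}$; write $w^k=e^{-\phi}$. It is quasi-Einstein with quasi-Einstein constant $c$ if $\mathrm{Ric}_\phi^k:=\mathrm{Ric}-kw^{-1}\nabla^2w=c\,g$. Its characteristic constant is then the constant $d$ such that $R_\phi^k+k\,d\,w^{-2}=(k+n)c$, where $R_\phi^k=R+2\Delta\phi-\frac{k+1}{k}|\nabla\phi|^2$. In the statement $k=2-m-n$, $w=u$, $c=\mu$, $d=\lambda$. *)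

(* Defs.v *)
From HB Require Import structures.
From mathcomp Require Import all_boot all_order all_algebra.
From mathcomp Require Import all_classical all_reals all_analysis.
Set Implicit Arguments.
Unset Strict Implicit.
Unset Printing Implicit Defensive.
Import Order.TTheory GRing.Theory Num.Theory.
Import numFieldNormedType.Exports.
Local Open Scope classical_set_scope.
Local Open Scope ring_scope.

(* Smooth manifolds are given by a smooth atlas, and Riemannian metrics by     *)
(* their components in the charts of this atlas. Tensors at a point p are      *)
(* expressed by their components in a chart whose domain contains p.           *)

Section Euclidean.
Variables (R : realType) (n : nat).
Implicit Types (f : 'rV[R]_n -> R) (x : 'rV[R]_n) (D : set 'rV[R]_n).

Definition partial (i : 'I_n) f : 'rV[R]_n -> R :=
  fun x => 'D_(delta_mx 0 i) f x.

Definition iter_partial (s : seq 'I_n) f : 'rV[R]_n -> R := foldr partial f s.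

(* C^oo on an open set: partial derivatives of all orders exist and are        *)
(* differentiable (hence continuous). The values of f outside of D do not      *)
(* matter because D is meant to be open.                                       *)
Definition smooth_on D f : Prop :=
  forall (s : seq 'I_n) x, D x -> differentiable (iter_partial s f) x.

(* In what follows, g x is the matrix (g_ij) of a metric at x.                 *)
Implicit Types g : 'rV[R]_n -> 'M[R]_n.

(* christoffel g k i j = Gamma^k_ij *)
Definition christoffel g (k i j : 'I_n) x : R :=
  2^-1 * \sum_(l < n) invmx (g x) k l *
    (partial i (fun y => g y j l) x + partial j (fun y => g y i l) x
     - partial l (fun y => g y i j) x).

(* riemann g l i j k = R_ijk^l, where R(d_i, d_j) d_k = \sum_l R_ijk^l d_l and *)
(* R(X, Y) = [nabla_X, nabla_Y] - nabla_[X, Y].                                *)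
Definition riemann g (l i j k : 'I_n) x : R :=
  partial i (christoffel g l j k) x - partial j (christoffel g l i k) x
  + \sum_(s < n) (christoffel g l i s x * christoffel g s j k x
                  - christoffel g l j s x * christoffel g s i k x).

(* Ric(Y, Z) is the trace of X |-> R(X, Y) Z; positive on round spheres.       *)
Definition ricci g x : 'M[R]_n :=
  \matrix_(j, k) \sum_(i < n) riemann g i i j k x.

Definition hessian g f x : 'M[R]_n :=
  \matrix_(i, j) (partial i (partial j f) x
                  - \sum_(k < n) christoffel g k i j x * partial k f x).

Definition metric_trace g (T : 'rV[R]_n -> 'M[R]_n) x : R :=
  \sum_(i < n) \sum_(j < n) invmx (g x) i j * T x i j.

Definition scalar_curv g x : R := metric_trace g (ricci g) x.

Definition laplacian g f x : R := metric_trace g (hessian g f) x.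

Definition grad_sqnorm g f x : R :=
  \sum_(i < n) \sum_(j < n) invmx (g x) i j * (partial i f x * partial j f x).

End Euclidean.

(* Connected, boundaryless smooth manifolds of dimension n.                    *)
Record manifold (R : realType) (n : nat) := Manifold {
  carrier :> topologicalType;
  space_hausdorff : hausdorff_space carrier;
  space_second_countable : @second_countable carrier;
  space_connected : connected [set: carrier];
  chart : Type;
  chart_dom : chart -> set carrier;
  to_coord : chart -> carrier -> 'rV[R]_n;
  of_coord : chart -> 'rV[R]_n -> carrier;
  dom_open : forall c, open (chart_dom c);
  dom_cover : forall p, exists c, chart_dom c p;
  coord_open : forall c, open (to_coord c @` chart_dom c);
  coordK : forall c p, chart_dom c p -> of_coord c (to_coord c p) = p;
  coord_continuous : forall c p, chart_dom c p -> {for p, continuous (to_coord c)};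
  param_continuous : forall c p, chart_dom c p ->
    {for to_coord c p, continuous (of_coord c)};
  transition_smooth : forall c c' (i : 'I_n),
    smooth_on (to_coord c @` (chart_dom c `&` chart_dom c'))
              (fun x => to_coord c' (of_coord c x) 0 i) }.

Section Functions.
Variables (R : realType) (n : nat) (M : manifold R n).

Definition local_expr (f : M -> R) (c : chart M) : 'rV[R]_n -> R :=
  f \o of_coord c.

Definition smooth_fun (f : M -> R) : Prop :=
  forall c, smooth_on (to_coord c @` chart_dom c) (local_expr f c).

End Functions.

Record riemannian_manifold (R : realType) (n : nat) := RiemannianManifold {
  underlying :> manifold R n;
  metric : chart underlying -> 'rV[R]_n -> 'M[R]_n;
  metric_smooth : forall c (i j : 'I_n),
    smooth_on (to_coord c @` chart_dom c) (fun x => metric c x i j);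
  metric_sym : forall (c : chart underlying) p, chart_dom c p ->
    (metric c (to_coord c p))^T = metric c (to_coord c p);
  metric_posdef : forall (c : chart underlying) p, chart_dom c p ->
    forall v : 'rV[R]_n, v != 0 ->
    0 < (v *m metric c (to_coord c p) *m v^T) 0 0;
  (* jacobian acts on row vectors from the right *)
  metric_change : forall (c c' : chart underlying) p,
    chart_dom c p -> chart_dom c' p ->
    let J := jacobian (to_coord c' \o of_coord c) (to_coord c p) in
    metric c (to_coord c p) = J *m metric c' (to_coord c' p) *m J^T }.

(* (M, g, w^k dvol_g, k): the measure is determined by g, w and k.             *)
Record smms (R : realType) (n : nat) (k : R) := SMMS {
  smms_space :> riemannian_manifold R n;
  weight : smms_space -> R;
  smms_dim_neq0 : k != 0;
  weight_gt0 : forall p, 0 < weight p;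
  weight_smooth : smooth_fun weight }.

Arguments weight {R n k} s _.

Section SMMS.
Variables (R : realType) (n : nat) (k : R) (X : smms n k).
Implicit Types (c : chart X) (p : X).

(* w^k = e^-phi *)
Definition phi p : R := - ln (weight X p `^ k).

Definition bakry_emery_ricci c p : 'M[R]_n :=
  ricci (metric c) (to_coord c p)
  - (k * (weight X p)^-1) *:
      hessian (metric c) (local_expr (weight X) c) (to_coord c p).

Definition weighted_scalar_curv c p : R :=
  scalar_curv (metric c) (to_coord c p)
  + 2 * laplacian (metric c) (local_expr phi c) (to_coord c p)
  - (k + 1) / k * grad_sqnorm (metric c) (local_expr phi c) (to_coord c p).

Definition quasi_einstein (mu : R) : Prop :=
  forall c p, chart_dom c p ->
    bakry_emery_ricci c p = mu *: metric c (to_coord c p).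

Definition characteristic_constant (mu lambda : R) : Prop :=
  forall c p, chart_dom c p ->
    weighted_scalar_curv c p + k * lambda * (weight X p) ^- 2
    = (k + n%:R) * mu.

End SMMS.

(* Main.v *)
(* The Bochner formula gives an elliptic inequality for F / u^2, where
   F = |grad u|^2 + lambda / (m+n-1), from which the weak bound
   F / u^2 <= mu / (m-1) follows by evaluating it at a maximum. To get the strict
   bound without the strong maximum principle, suppose F / u^2 >= mu / (m-1) at
   some point and look instead at a maximum of F / u^2 + eps u^P, where P is a
   large exponent and eps > 0 is small: its value exceeds mu / (m-1), the quotient
   (Lap u) / u is positive there, and Bochner's formula together with the
   Cauchy-Schwarz inequality (Lap u)^2 <= n |Hess u|^2 is contradicted at that
   point. *)
Require Import Defs.
From mathcomp Require Import all_boot all_order all_algebra.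
From mathcomp Require Import all_classical all_reals all_analysis.
From mathcomp Require Import ring lra.
Import Order.TTheory GRing.Theory Num.Theory.
Import numFieldNormedType.Exports.
Local Open Scope classical_set_scope.
Local Open Scope ring_scope.

Set Implicit Arguments.
Unset Strict Implicit.
Unset Printing Implicit Defensive.

(** * Partial derivatives and smooth functions *)

(** With N = m+n-1, the two structure equations combine into u Lap u = lambda + N |grad u|^2 - mu
    u^2, so y = (Lap u) / u equals N F / u^2 - mu. Using this and its derivative along grad u in
    Bochner's formula leaves only F / u^2, |grad u|^2 and |Hess u|^2. For eps = 0, at a maximum Y of
    F / u^2, the |grad u|^2 terms cancel identically and Cauchy-Schwarz leaves y (mu - (m-1) Y) >=
    0. When Y = mu / (m-1) this reads 0 >= 0, so equality in the bound is not excluded; adding eps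
    u^P pushes the maximum strictly above this value. The price is two error terms, with factors P
    (P+2-N) |grad u|^2 and n P - 2 (m-1), and both have the favourable sign for P large. Smallness
    of eps only serves to keep y > 0, so that y can be divided out. *)

Lemma near_eq_differentiable (R : numFieldType) (V W : normedModType R)
    (f g : V -> W) x :
  (\near x, f x = g x) -> differentiable f x -> differentiable g x.
Proof.
move=> fg df; have fgx : f x = g x by apply: nbhs_singleton fg.
have cd : continuous ('d f x) by exact: diff_continuous.
have gE : g \o shift x = cst (g x) + 'd f x +o_ 0 id.
  apply/eqaddoP => _/posnumP[e].
  have /eqaddoP/(_ e%:num)/(_ [gt0 of e%:num]) := diff_locally df.
  rewrite -fgx.
  have fg0 : \forall h \near 0, f (h + x) = g (h + x).
    by have := fg; rewrite (near_shift 0 x); apply: filterS => h; rewrite /= subr0.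
  by apply: filterS2 fg0 => h /= fgh; rewrite /= !fctE /= fgh.
by apply/diff_locallyP; rewrite (diff_unique cd gE).
Qed.

Section PartialDerivatives.
Variables (R : realType) (n : nat).
Implicit Types (f g : 'rV[R]_n -> R) (x : 'rV[R]_n).

Lemma partialD i f g x : differentiable f x -> differentiable g x ->
  partial i (fun y => f y + g y) x = partial i f x + partial i g x.
Proof. by move=> df dg; apply: deriveD; exact: diff_derivable. Qed.

Lemma partialN i f x : differentiable f x ->
  partial i (fun y => - f y) x = - partial i f x.
Proof. by move=> df; apply: deriveN; exact: diff_derivable. Qed.

Lemma partialM i f g x : differentiable f x -> differentiable g x ->
  partial i (fun y => f y * g y) x = f x * partial i g x + g x * partial i f x.
Proof. by move=> df dg; apply: deriveM; exact: diff_derivable. Qed.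

Lemma partialV i f x : f x != 0 -> differentiable f x ->
  partial i (fun y => (f y)^-1) x = - (f x)^-1 ^+ 2 * partial i f x.
Proof.
by move=> f0 df; rewrite /partial deriveV ?exprVn //; exact: diff_derivable.
Qed.

Lemma partial_cst i (a : R) x : partial i (fun=> a) x = 0.
Proof. exact: derive_cst. Qed.

Lemma partial_sum i (I : Type) (s : seq I) (F : I -> 'rV[R]_n -> R) x :
  (forall j, differentiable (F j) x) ->
  differentiable (fun y => \sum_(j <- s) F j y) x /\
  partial i (fun y => \sum_(j <- s) F j y) x = \sum_(j <- s) partial i (F j) x.
Proof.
move=> dF; elim: s => [|j s [IHd IHp]].
  rewrite big_nil; under [X in partial _ X]eq_fun do rewrite big_nil.
  under [X in differentiable X _]eq_fun do rewrite big_nil.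
  by split; [exact: differentiable_cst|exact: partial_cst].
rewrite big_cons; under [X in partial _ X]eq_fun do rewrite big_cons.
under [X in differentiable X _]eq_fun do rewrite big_cons.
by split; [exact: differentiableD|rewrite partialD// IHp].
Qed.

Lemma derive_partial f x (v : 'rV[R]_n) : differentiable f x ->
  'D_v f x = \sum_i v 0 i * partial i f x.
Proof.
move=> df; rewrite deriveE// {1}(row_sum_delta v) linear_sum.
by apply: eq_bigr => i _; rewrite linearZ/= /partial deriveE.
Qed.

End PartialDerivatives.

(** * Closure properties of smooth functions on an open set *)

Section Smooth.
Variables (R : realType) (n : nat) (D : set 'rV[R]_n).
Hypothesis D_open : open D.
Implicit Types (f g : 'rV[R]_n -> R) (x : 'rV[R]_n).

Lemma eq_on_near f g x : D x -> {in D, f =1 g} -> \near x, f x = g x.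
Proof.
move=> Dx fg; have := open_nbhs_nbhs (conj D_open Dx).
by apply: filterS => y Dy; apply: fg; rewrite inE.
Qed.

Lemma eq_on_partial i f g : {in D, f =1 g} -> {in D, partial i f =1 partial i g}.
Proof.
move=> fg x; rewrite inE => Dx.
by apply: near_eq_derive; exact: eq_on_near.
Qed.

(** A partial derivative of a product is a sum of products, so closure of [smooth_on] under products
    is not an induction on the sequence of indices. Stratifying by order gives classes each closed
    under sums and products, and the induction runs on [k]. *)
Fixpoint Ck k f : Prop :=
  (forall x, D x -> differentiable f x) /\
  if k is k'.+1 then forall i, Ck k' (partial i f) else True.

Lemma smooth_Ck f : smooth_on D f <-> forall k, Ck k f.
Proof.
split=> [sf k|Cf s].
  elim: k f sf => [|k IH] f sf /=; (split; first by move=> x; exact: (sf [::])) => //.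
  move=> i; apply: IH => s x Dx.
  by have := sf (rcons s i) x Dx; rewrite /iter_partial foldr_rcons.
(* [iter_partial] applies the last index first, so the sequence is peeled from its right end. *)
elim/last_ind: s f Cf => [|s i IH] f Cf x Dx; first by case: (Cf 0%N) => + _; exact.
rewrite /iter_partial foldr_rcons; apply: IH => // k.
by case: (Cf k.+1) => _; exact.
Qed.

Lemma CkW k f : Ck k.+1 f -> Ck k f.
Proof.
elim: k f => [|k IH] f [df pf]; split=> // i.
exact/IH/pf.
Qed.

Lemma Ck_ext k f g : {in D, f =1 g} -> Ck k f -> Ck k g.
Proof.
elim: k f g => [|k IH] f g fg [df pf]; (split=> [x Dx|//]; first
  by apply: near_eq_differentiable (df x Dx); exact: eq_on_near).
by move=> i; apply: IH (pf i); exact: eq_on_partial.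
Qed.

Lemma Ck_cst k (a : R) : Ck k (fun=> a).
Proof.
elim: k a => [|k IH] a; (split=> [x _|//]; first exact: differentiable_cst).
by move=> i; apply: Ck_ext (IH 0) => x _; rewrite partial_cst.
Qed.

Lemma CkD k f g : Ck k f -> Ck k g -> Ck k (fun y => f y + g y).
Proof.
elim: k f g => [|k IH] f g [df pf] [dg pg];
  (split=> [x Dx|//]; first by apply: differentiableD; auto).
move=> i; apply: Ck_ext (IH _ _ (pf i) (pg i)) => x; rewrite inE => Dx.
by rewrite partialD; auto.
Qed.

Lemma CkN k f : Ck k f -> Ck k (fun y => - f y).
Proof.
elim: k f => [|k IH] f [df pf];
  (split=> [x Dx|//]; first by apply: differentiableN; auto).
move=> i; apply: Ck_ext (IH _ (pf i)) => x; rewrite inE => Dx.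
by rewrite partialN; auto.
Qed.

Lemma CkM k f g : Ck k f -> Ck k g -> Ck k (fun y => f y * g y).
Proof.
elim: k f g => [|k IH] f g Cf Cg; have [df pf] := Cf; have [dg pg] := Cg;
  (split=> [x Dx|//]; first by apply: differentiableM; auto).
move=> i.
have Cf' := CkW Cf; have Cg' := CkW Cg.
apply: Ck_ext (CkD (IH _ _ Cf' (pg i)) (IH _ _ Cg' (pf i))) => x.
by rewrite inE => Dx; rewrite partialM; auto.
Qed.

Lemma CkV k f : (forall x, D x -> f x != 0) -> Ck k f ->
  Ck k (fun y => (f y)^-1).
Proof.
move=> f0; elim: k f f0 => [|k IH] f f0 Cf; have [df pf] := Cf;
  (split=> [x Dx|//]; first by apply: differentiableV; auto).
move=> i.
have CV := IH _ f0 (CkW Cf).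
apply: Ck_ext (CkM (CkN (CkM CV CV)) (pf i)) => x.
by rewrite inE => Dx; rewrite partialV ?expr2; auto.
Qed.

Lemma smooth_diff f x : smooth_on D f -> D x -> differentiable f x.
Proof. by move=> sf; exact: (sf [::]). Qed.

Lemma smooth_partial i f : smooth_on D f -> smooth_on D (partial i f).
Proof.
by move=> /smooth_Ck Cf; apply/smooth_Ck => k; case: (Cf k.+1) => _; exact.
Qed.

Lemma smooth_ext f g : {in D, f =1 g} -> smooth_on D f -> smooth_on D g.
Proof.
by move=> fg /smooth_Ck Cf; apply/smooth_Ck => k; apply: Ck_ext (Cf k).
Qed.

Lemma smooth_cst (a : R) : smooth_on D (fun=> a).
Proof. by apply/smooth_Ck => k; exact: Ck_cst. Qed.

Lemma smoothD f g : smooth_on D f -> smooth_on D g ->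
  smooth_on D (fun y => f y + g y).
Proof.
by move=> /smooth_Ck Cf /smooth_Ck Cg; apply/smooth_Ck => k; apply: CkD.
Qed.

Lemma smoothN f : smooth_on D f -> smooth_on D (fun y => - f y).
Proof. by move=> /smooth_Ck Cf; apply/smooth_Ck => k; apply: CkN. Qed.

Lemma smoothM f g : smooth_on D f -> smooth_on D g ->
  smooth_on D (fun y => f y * g y).
Proof.
by move=> /smooth_Ck Cf /smooth_Ck Cg; apply/smooth_Ck => k; apply: CkM.
Qed.

Lemma smoothX f q : smooth_on D f -> smooth_on D (fun y => f y ^+ q).
Proof.
move=> sf; elim: q => [|q IH].
  by apply: smooth_ext (smooth_cst 1) => y _; rewrite expr0.
by apply: smooth_ext (smoothM sf IH) => y _; rewrite exprS.
Qed.

Lemma smoothV f : (forall x, D x -> f x != 0) -> smooth_on D f ->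
  smooth_on D (fun y => (f y)^-1).
Proof. by move=> f0 /smooth_Ck Cf; apply/smooth_Ck => k; apply: CkV. Qed.

Lemma smooth_sum (I : Type) (s : seq I) (F : I -> 'rV[R]_n -> R) :
  (forall j, smooth_on D (F j)) -> smooth_on D (fun y => \sum_(j <- s) F j y).
Proof.
move=> sF; elim: s => [|j s IH].
  by apply: smooth_ext (smooth_cst 0) => y _; rewrite big_nil.
by apply: smooth_ext (smoothD (sF j) IH) => y _; rewrite big_cons.
Qed.

Lemma smooth_prod (I : Type) (s : seq I) (F : I -> 'rV[R]_n -> R) :
  (forall j, smooth_on D (F j)) -> smooth_on D (fun y => \prod_(j <- s) F j y).
Proof.
move=> sF; elim: s => [|j s IH].
  by apply: smooth_ext (smooth_cst 1) => y _; rewrite big_nil.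
by apply: smooth_ext (smoothM (sF j) IH) => y _; rewrite big_cons.
Qed.

Lemma smooth_det m (A : 'rV[R]_n -> 'M[R]_m) :
  (forall i j, smooth_on D (fun y => A y i j)) ->
  smooth_on D (fun y => \det (A y)).
Proof.
move=> sA; rewrite /determinant; apply: smooth_sum => s; apply: smoothM.
  exact: smooth_cst.
by apply: smooth_prod => i.
Qed.

(** Cramer's rule: an entry of the inverse is a cofactor over the determinant, and both are
    polynomial in the entries of [A]. *)
Lemma smooth_invmx m (A : 'rV[R]_n -> 'M[R]_m) i j :
  (forall x, D x -> A x \in unitmx) ->
  (forall i j, smooth_on D (fun y => A y i j)) ->
  smooth_on D (fun y => invmx (A y) i j).
Proof.
move=> uA sA.
have sV : smooth_on D (fun y => (\det (A y))^-1 * cofactor (A y) j i).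
  apply: smoothM.
    apply: smoothV (smooth_det sA) => x Dx.
    by have := uA x Dx; rewrite unitmxE unitfE.
  rewrite /cofactor; apply: smoothM (smooth_cst _) _.
  apply: smooth_det => a b.
  by apply: smooth_ext (sA (lift j a) (lift i b)) => y _; rewrite !mxE.
by apply: smooth_ext sV => y; rewrite inE => Dy; rewrite /invmx uA// !mxE.
Qed.

End Smooth.

(** * Second derivatives *)

Lemma near_ball (R : realType) (V : normedModType R) (x : V) (P : set V) :
  (\forall y \near x, P y) ->
  exists2 d, 0 < d & forall h, `|h| < d -> P (x + h).
Proof.
move=> /nbhs_ballP[d /= d0 dP]; exists d => // h hd.
by apply: dP; rewrite -ball_normE/= opprD addNKr normrN.
Qed.

Section SecondOrder.
Variables (R : realType) (V : normedModType R).
Implicit Types (f : V -> R) (x a b v : V).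

Lemma is_derive_line f x v (t : R) : differentiable f (x + t *: v) ->
  is_derive t 1 (fun s : R => f (x + s *: v)) ('D_v f (x + t *: v)).
Proof.
move=> df.
have il : is_diff t (fun s : R => x + s *: v) (fun s : R => s *: v).
  have h : is_diff t (cst x + *:%R^~ v) (0 + *:%R^~ v) by exact: is_diffD.
  by rewrite add0r in h.
have dl : differentiable (fun s : R => x + s *: v) t by [].
have dc := differentiable_comp dl df.
apply: DeriveDef; first exact: diff_derivable dc.
rewrite deriveE // diff_comp //= deriveE //; congr ('d f _ _).
by rewrite (@diff_val _ _ _ _ _ _ _ il) scale1r.
Qed.

(* The second difference is symmetric in a and b, whence derive_comm below. *)
Lemma second_difference f x a b :
  (\forall y \near x, differentiable f y) -> differentiable ('D_a f) x ->
  forall e, 0 < e -> exists2 d, 0 < d & forall t, 0 < t < d ->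
    `|f (x + t *: a + t *: b) - f (x + t *: a) - f (x + t *: b) + f x
      - t ^+ 2 * 'D_b ('D_a f) x| <= e * t ^+ 2.
Proof.
move=> ndf dg e e0; set g := 'D_a f.
(* The two linearization errors below are at most e / M times t (|a| + |b|) and t |a|, hence at most
   e t together; the 1 keeps [M] positive when [a] and [b] vanish. *)
pose M := `|a| + `|a| + `|b| + 1.
have M0 : 0 < M by rewrite ltr_wpDl ?addr_ge0.
have gN : \forall h \near (0 : V), `|g (h + x) - (g x + 'd g x h)| <= e / M * `|h|.
  have /eqaddoP/(_ (e / M)) := diff_locally dg.
  by apply; rewrite divr_gt0.
have [d1 d10 hd1] := near_ball ndf.
have [d2 d20 hd2] := near_ball gN.
exists (Num.min d1 d2 / M); first by rewrite divr_gt0 // lt_min d10.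
move=> t /andP[t0]; rewrite ltr_pdivlMr // lt_min => /andP[tM1 tM2].
have small c c' : 0 <= c <= t -> 0 <= c' <= t -> `|c *: a + c' *: b| <= t * (`|a| + `|b|).
  move=> /andP[c0 ct] /andP[c'0 c't]; rewrite (le_trans (ler_normD _ _)) //.
  by rewrite !normrZ !ger0_norm // mulrDr lerD // ler_wpM2r.
have smallM : t * (`|a| + `|b|) < t * M.
  by rewrite ltr_pM2l // /M; have := normr_ge0 a; lra.
have t00 : 0 <= t <= t by rewrite lexx ltW.
(* The second difference is [phi t - phi 0]. One mean value theorem in direction [a] turns it into a
   difference of two values of [g], for which differentiability of [g] at the single point [x] is
   enough. *)
pose phi s := f (x + t *: b + s *: a) - f (x + s *: a).
have dphi s : 0 <= s <= t ->
    is_derive s 1 phi (g (x + t *: b + s *: a) - g (x + s *: a)).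
  move=> st; apply: is_deriveB; apply: is_derive_line.
    rewrite -addrA (addrC (t *: b)); apply: hd1.
    by rewrite (le_lt_trans (small _ _ st t00)) // (lt_trans smallM).
  rewrite -[s *: a]addr0 -(scale0r b) ; apply: hd1.
  rewrite (le_lt_trans (small _ _ st _)) // ?(lt_trans smallM) //.
  by apply/andP; split=> //; exact: ltW.
have cphi : {within `[0, t], continuous phi}.
  apply: continuous_in_subspaceT => s; rewrite inE /= in_itv /= => st.
  have [+ _] := dphi s st.
  by move/derivable1_diffP/differentiable_continuous.
have [c] := MVT t0 (fun s st => dphi s (subset_itv_oo_cc st)) cphi.
rewrite in_itv /= subr0 => /andP[c0 ct] phiE.
have cct : 0 <= c <= t by rewrite !ltW.
have -> : f (x + t *: a + t *: b) - f (x + t *: a) - f (x + t *: b) + f x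
    = phi t - phi 0.
  rewrite /phi !scale0r !addr0 (addrAC x (t *: b)).
  ring.
rewrite phiE; have gx h : `|h| <= t * (`|a| + `|b|) ->
    `|g (x + h) - g x - 'd g x h| <= e / M * `|h|.
  move=> ht; have := hd2 h; rewrite /= add0r (addrC h) opprD addrA; apply.
  by rewrite (le_lt_trans ht) // (lt_trans smallM).
have h1 := gx (c *: a + t *: b) (small _ _ cct t00).
have h2 : `|g (x + c *: a) - g x - 'd g x (c *: a)| <= e / M * (t * `|a|).
  have h0t : 0 <= (0 : R) <= t by apply/andP; split=> //; exact: ltW.
  have := small _ _ cct h0t; rewrite scale0r addr0 => /gx /le_trans; apply.
  apply: ler_wpM2l; first exact/ltW/divr_gt0.
  by rewrite normrZ gtr0_norm //; apply: ler_wpM2r => //; exact: ltW.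
have h1' := le_trans h1 (ler_wpM2l (ltW (divr_gt0 e0 M0)) (small _ _ cct t00)).
have -> : (g (x + t *: b + c *: a) - g (x + c *: a)) * t - t ^+ 2 * 'D_b g x =
   t * ((g (x + (c *: a + t *: b)) - g x - 'd g x (c *: a + t *: b)) -
        (g (x + c *: a) - g x - 'd g x (c *: a))).
  rewrite linearD !linearZ /= deriveE // -(addrA x (t *: b)) (addrC (t *: b)).
  rewrite /GRing.scale /=; ring.
rewrite normrM gtr0_norm // expr2 mulrCA ler_pM2l //.
rewrite (le_trans (ler_normB _ _)) // (le_trans (lerD h1' h2)) //.
rewrite -mulrDr -mulrDr -mulrA ler_pM2l // ler_pdivrMl // mulrC ler_pM2r //.
by rewrite /M; lra.
Qed.

Lemma derive_comm f x a b : (\forall y \near x, differentiable f y) ->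
  differentiable ('D_a f) x -> differentiable ('D_b f) x ->
  'D_a ('D_b f) x = 'D_b ('D_a f) x.
Proof.
move=> ndf da db; apply/eqP; rewrite -subr_eq0 -normr_le0.
apply/ler_addgt0Pl => e e0; rewrite addr0.
have e20 : 0 < e / 2 by rewrite divr_gt0.
have [d1 d10 h1] := second_difference b ndf da e20.
have [d2 d20 h2] := second_difference a ndf db e20.
pose t := Num.min d1 d2 / 2.
have t0 : 0 < t by rewrite divr_gt0 // lt_min d10.
have tm : t < Num.min d1 d2 by rewrite ltr_pdivrMr // ltr_pMr ?ltr1n // lt_min d10.
have /h1 {}h1 : 0 < t < d1 by rewrite t0 (lt_le_trans tm) // ge_min lexx.
have /h2 {}h2 : 0 < t < d2 by rewrite t0 (lt_le_trans tm) // ge_min lexx orbT.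
have t20 : 0 < t ^+ 2 by rewrite exprn_gt0.
rewrite -(ler_pM2r t20) -[X in `|_| * X]gtr0_norm // -normrM.
move: h1 h2; rewrite (addrAC x (t *: b)).
set A := f _; set B := f _; set C := f _.
set X := 'D_b _ _; set Y := 'D_a _ _ => h1 h2.
have -> : (Y - X) * t ^+ 2 = (A - B - C + f x - t ^+ 2 * X) - (A - C - B + f x - t ^+ 2 * Y).
  ring.
rewrite (le_trans (ler_normB _ _)) // (le_trans (lerD h1 h2)) //.
by rewrite -mulrDl -splitr.
Qed.

(** Everything happens on the line through [x] along [v]. If the second derivative were positive,
    the first one, being 0 at [x], would be positive just after it, and the mean value theorem would
    give values above [f x]. *)
Lemma derive_local_max f x v : (\forall y \near x, differentiable f y) ->
  (\forall y \near x, f y <= f x) ->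
  'D_v f x = 0 /\ (differentiable ('D_v f) x -> 'D_v ('D_v f) x <= 0).
Proof.
move=> ndf nmax.
have [d d0 hd] : exists2 d, 0 < d & forall h, `|h| < d ->
    differentiable f (x + h) /\ f (x + h) <= f x.
  apply: (@near_ball _ _ x (fun y => differentiable f y /\ f y <= f x)).
  by near=> y; split; near: y.
pose r := d / (`|v| + 1).
have v1 : 0 < `|v| + 1 by rewrite ltr_wpDl.
have r0 : 0 < r by rewrite divr_gt0.
have hr (s : R) : `|s| < r -> differentiable f (x + s *: v) /\ f (x + s *: v) <= f x.
  rewrite ltr_pdivlMr // => sr; apply: hd; rewrite normrZ (le_lt_trans _ sr) //.
  by rewrite ler_wpM2l // lerDl.
pose phi (s : R) := f (x + s *: v).
have dphi (s : R) : `|s| < r -> is_derive s 1 phi ('D_v f (x + s *: v)).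
  by move=> /hr[dfs _]; exact: is_derive_line.
have x0 : x + 0 *: v = x by rewrite scale0r addr0.
have itvr s : s \in `]- r, r[ -> `|s| < r by rewrite in_itv /= ltr_norml.
have D0 : 'D_v f x = 0.
  have dv0 : is_derive (0 : R) 1 phi ('D_v f x).
    by rewrite -[in 'D_v f x]x0; apply: dphi; rewrite normr0.
  have d00 : is_derive (0 : R) 1 phi 0.
    apply: (@derive1_at_max _ phi (- r) r 0).
    - by move: r0; clear; lra.
    - by move=> t /itvr/dphi[].
    - by rewrite in_itv /= oppr_lt0 r0.
    - by move=> t /itvr/hr[_]; rewrite /phi x0.
  by rewrite -(@derive_val _ _ _ _ _ _ _ dv0) (@derive_val _ _ _ _ _ _ _ d00).
split=> // dg; rewrite leNgt; apply/negP => L0.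
pose psi (s : R) := 'D_v f (x + s *: v).
have : is_derive (0 : R) 1 psi ('D_v ('D_v f) (x + 0 *: v)).
  by apply: is_derive_line; rewrite x0.
rewrite x0 => -[cg gE].
have : \forall h \near (0 : R)^', 0 < (h : R)^-1 * (psi (h * 1 + 0) - psi 0).
  by apply: (cvgr_gt _ cg); move: gE; rewrite /derive => ->.
rewrite near_withinE => /near_ball[r2 r20 hr2]; clear cg gE L0 dg.
pose t := Num.min r r2 / 2.
have t0 : 0 < t by rewrite divr_gt0 // lt_min r0.
have : t < Num.min r r2 by rewrite ltr_pdivrMr // ltr_pMr ?ltr1n // lt_min r0.
rewrite lt_min => /andP[tr tr2].
have dphit s : 0 <= s <= t -> is_derive s 1 phi ('D_v f (x + s *: v)).
  move=> /andP[s0 st]; apply: dphi; rewrite ger0_norm //.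
  exact: le_lt_trans tr.
have cphi : {within `[0, t], continuous phi}.
  apply: continuous_in_subspaceT => s; rewrite inE /= in_itv /= => st.
  have [+ _] := dphit s st.
  by move/derivable1_diffP/differentiable_continuous.
have [c] := MVT t0 (fun s st => dphit s (subset_itv_oo_cc st)) cphi.
rewrite in_itv /= subr0 => /andP[c0 ct] phiE.
have gc : 0 < 'D_v f (x + c *: v).
  have := hr2 c; rewrite /psi gtr0_norm // add0r gt_eqF // scale0r !addr0 D0 subr0.
  by rewrite mulr1 pmulr_rgt0 ?invr_gt0 //; apply => //; lra.
have tr' : `|t| < r by rewrite gtr0_norm.
have [_] := hr t tr'.
rewrite -subr_le0; have -> : f (x + t *: v) - f x = phi t - phi 0 by rewrite /phi x0.
by rewrite phiE leNgt mulr_gt0.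
Unshelve. all: by end_near. Qed.

End SecondOrder.

(** * Positive definite matrices *)

Section PositiveDefinite.
Variable R : realType.

Definition posdef n (A : 'M[R]_n) : Prop :=
  forall v : 'rV[R]_n, v != 0 -> 0 < (v *m A *m v^T) 0 0.

Lemma posdef_unitmx n (A : 'M[R]_n) : posdef A -> A \in unitmx.
Proof.
move=> pA; rewrite -row_free_unit -kermx_eq0; apply/eqP/row_matrixP => i.
rewrite row0; apply/eqP; apply/negPn/negP => /pA.
by rewrite -row_mul mulmx_ker row0 mul0mx mxE ltxx.
Qed.

Lemma posdef_invmx n (A : 'M[R]_n) : A^T = A -> posdef A ->
  (invmx A)^T = invmx A /\ posdef (invmx A).
Proof.
move=> sA pA; have uA := posdef_unitmx pA.
have sV : (invmx A)^T = invmx A by rewrite trmx_inv sA.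
split=> // v v0.
have : v *m invmx A != 0.
  by apply: contra v0 => /eqP h; rewrite -[v](mulmxKV uA) h mul0mx.
by move=> /pA; rewrite mulmxKV // trmx_mul sV mulmxA.
Qed.

(** Induction on the size through the Schur complement of the upper left entry. The factor [P] plays
    the role of an orthonormal frame in the trace inequalities below. *)
Lemma cholesky n (A : 'M[R]_n) : A^T = A -> posdef A ->
  exists P : 'M[R]_n, A = P^T *m P.
Proof.
elim: n A => [|n IH] A sA pA; first by exists 0; apply/matrixP => -[].
move: sA pA; rewrite -[A](@submxK _ 1 n 1 n).
set a := ulsubmx _; set b := ursubmx _; set b' := dlsubmx _; set d := drsubmx _.
rewrite (@tr_block_mx _ 1 n 1 n) => /(@eq_block_mx _ 1 n 1 n)[_ _ b'E dE] pA.
have {}b'E : b' = b^T by [].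
have a0 : 0 < a 0 0.
  have /pA : row_mx 1%:M 0 != 0 :> 'rV[R]_(1 + n).
    by rewrite row_mx_eq0 negb_and oner_eq0.
  rewrite (@tr_row_mx _ 1 1 n) (@mul_row_block _ 1 1 n 1 n).
  rewrite (@mul_row_col _ 1 1 n 1) !mul1mx !mul0mx.
  by rewrite trmx0 mulmx0 !addr0 trmx1 mulmx1.
have aM : a = (a 0 0)%:M by rewrite [LHS]mx11_scalar.
move: a0 aM; set s := a 0 0 => s0 aM.
pose d' := d - s^-1 *: (b^T *m b).
have [||P PE] := IH d'.
- by rewrite /d' linearB linearZ /= trmx_mul trmxK dE.
- move=> v v0.
  (* For a given [v] this first coordinate minimizes the quadratic form, and the minimum is the
     value of the Schur complement at [v]. *)
  have /pA : row_mx (- s^-1 *: (v *m b^T)) v != 0 :> 'rV[R]_(1 + n).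
    by rewrite row_mx_eq0 negb_and v0 orbT.
  rewrite (@tr_row_mx _ 1 1 n) (@mul_row_block _ 1 1 n 1 n).
  rewrite (@mul_row_col _ 1 1 n 1) aM b'E mul_mx_scalar.
  rewrite scalerA mulrN mulfV ?gt_eqF // scaleN1r addNr mul0mx add0r.
  by rewrite /d' -scalemxAl mulmxDr scaleNr mulmxN -scalemxAr mulmxA addrC.
exists (block_mx (Num.sqrt s)%:M ((Num.sqrt s)^-1 *: b) 0 P).
have ss : Num.sqrt s * Num.sqrt s = s by rewrite -expr2 sqr_sqrtr // ltW.
have sn0 : Num.sqrt s != 0 by rewrite gt_eqF // sqrtr_gt0.
rewrite [in RHS](@tr_block_mx _ 1 n 1 n) (@mulmx_block _ 1 n 1 n 1 n).
rewrite !trmx0 !mulmx0 !mul0mx !addr0 tr_scalar_mx -scalar_mxM ss -aM.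
rewrite mul_scalar_mx scalerA mulfV // scale1r.
rewrite linearZ /= mul_mx_scalar scalerA mulfV // scale1r -b'E.
rewrite -scalemxAl -scalemxAr scalerA -invfM ss -PE /d' b'E.
by rewrite addrC subrK.
Qed.

(** The diagonal entries have nonnegative variance, and by symmetry the off-diagonal entries add
    only squares to the trace of the square. *)
Lemma sqr_mxtrace_le n (A : 'M[R]_n) : A^T = A ->
  \tr A ^+ 2 <= n%:R * \tr (A *m A).
Proof.
move=> sA; case: n A sA => [|n] A sA.
  by rewrite /mxtrace !big_ord0 expr0n mul0r.
have n0 : 0 < n.+1%:R :> R by rewrite ltr0n.
set t := \tr A.
have h1 : \sum_i A i i ^+ 2 <= \tr (A *m A).
  apply: ler_sum => i _; rewrite mxE (bigD1 i) //= lerDl sumr_ge0 // => j _.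
  by rewrite -{2}sA mxE -expr2 sqr_ge0.
rewrite (le_trans _ (ler_wpM2l (ltW n0) h1)) //.
have : 0 <= \sum_i (n.+1%:R * A i i - t) ^+ 2 by apply: sumr_ge0 => i _; exact: sqr_ge0.
have -> : \sum_i (n.+1%:R * A i i - t) ^+ 2 =
    n.+1%:R ^+ 2 * (\sum_i A i i ^+ 2) - 2 * n.+1%:R * t * t + n.+1%:R * t ^+ 2.
  rewrite (eq_bigr (fun i => n.+1%:R ^+ 2 * A i i ^+ 2 +
    (- (2 * n.+1%:R * t) * A i i + t ^+ 2))); last by move=> i _; ring.
  rewrite !big_split /= -!mulr_sumr sumr_const card_ord -[\sum_i A i i]/t.
  rewrite -[_ *+ n.+1]mulr_natl; ring.
rewrite [X in 0 <= X](_ : _ = n.+1%:R * (n.+1%:R * (\sum_i A i i ^+ 2) - t ^+ 2)); last by ring.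
by rewrite pmulr_rge0 // subr_ge0.
Qed.

(** Cyclicity of the trace replaces [h *m H] by the symmetric matrix [P *m H *m P^T]. With [h] the
    inverse metric and [H] the Hessian of u this is (Lap u)^2 <= n |Hess u|^2. *)
Lemma sqr_trace_posdef_le n (h H : 'M[R]_n) : h^T = h -> posdef h -> H^T = H ->
  \tr (h *m H) ^+ 2 <= n%:R * \tr (h *m H *m (h *m H)).
Proof.
move=> sh ph sH; have [P ->] := cholesky sh ph.
have -> : \tr (P^T *m P *m H) = \tr (P *m H *m P^T).
  by rewrite -mulmxA mxtrace_mulC.
have -> : \tr (P^T *m P *m H *m (P^T *m P *m H)) =
    \tr (P *m H *m P^T *m (P *m H *m P^T)).
  by rewrite -!mulmxA mxtrace_mulC !mulmxA.
by apply: sqr_mxtrace_le; rewrite !trmx_mul trmxK sH mulmxA.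
Qed.

(** Factoring [h] as [P^T *m P] makes the contraction a sum of values of the form [T] on the rows of
    [P]. It serves to pass from second directional derivatives at a maximum to the Laplacian. *)
Lemma trace_posdef_le0 n (h T : 'M[R]_n) : h^T = h -> posdef h ->
  (forall v : 'rV[R]_n, \sum_i \sum_j v 0 i * v 0 j * T i j <= 0) ->
  \sum_i \sum_j h i j * T i j <= 0.
Proof.
move=> sh ph nT; have [P ->] := cholesky sh ph.
have -> : \sum_i \sum_j (P^T *m P) i j * T i j =
  \sum_a \sum_i \sum_j (row a P) 0 i * (row a P) 0 j * T i j.
  rewrite [RHS]exchange_big /=; apply: eq_bigr => i _.
  rewrite [RHS]exchange_big /=; apply: eq_bigr => j _.
  by rewrite mxE mulr_suml; apply: eq_bigr => a _; rewrite !mxE.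
by apply: sumr_le0 => a _; exact: nT.
Qed.

End PositiveDefinite.

(** * Bochner formula in local coordinates *)

(* Here V is a vector field at a point, dV i l = d_i V^l, ddV i j l = d_i d_j V^l,
   G l i j = Gamma^l_ij and dG i l j k = d_i Gamma^l_jk; then A l j = nabla_j V^l,
   dA i l j = d_i (nabla_j V^l) and Rm l i j k = R_ijk^l. *)
Section BochnerAlgebra.
Variables (R : comPzRingType) (I : finType).
Variables (V : I -> R) (dV : I -> I -> R) (ddV G : I -> I -> I -> R).
Variable dG : I -> I -> I -> I -> R.
Hypothesis ddV_sym : forall i j l, ddV i j l = ddV j i l.
Hypothesis G_sym : forall l i j, G l i j = G l j i.

Let A l j := dV j l + \sum_k G l j k * V k.
Let dA i l j := ddV i j l + \sum_k (dG i l j k * V k + G l j k * dV i k).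
Let Rm l i j k :=
  dG i l j k - dG j l i k + \sum_s (G l i s * G s j k - G l j s * G s i k).

(** Commutation of second covariant derivatives of V. The remaining correction, the sum over s of
    Gamma^s_ij nabla_s V^l, is symmetric in i and j and is left out on both sides. *)
Lemma ricci_identity l i j :
  dA i l j + \sum_s G l i s * A s j =
  dA j l i + \sum_s G l j s * A s i + \sum_k Rm l i j k * V k.
Proof.
have e1 i' j' : \sum_s G l i' s * A s j' =
    \sum_s G l i' s * dV j' s + \sum_k (\sum_s G l i' s * G s j' k) * V k.
  rewrite (eq_bigr _ (fun s _ => mulrDr _ _ _)) big_split /=; congr (_ + _).
  under [RHS]eq_bigr do rewrite mulr_suml.
  rewrite [RHS]exchange_big /=; apply: eq_bigr => s _.
  by rewrite mulr_sumr; apply: eq_bigr => k _; rewrite mulrA.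
have e2 : \sum_k Rm l i j k * V k = \sum_k dG i l j k * V k - \sum_k dG j l i k * V k
    + (\sum_k (\sum_s G l i s * G s j k) * V k - \sum_k (\sum_s G l j s * G s i k) * V k).
  rewrite -!sumrB -big_split /=; apply: eq_bigr => k _.
  by rewrite /Rm sumrB; ring.
rewrite !e1 e2 /dA (ddV_sym i j) !big_split /=; ring.
Qed.

(** The left side is the divergence of the field with components V^a nabla_a V^i; the right side is
    V(div V) + Ric(V, V) + tr((nabla V)^2). The proof is the contracted Ricci identity. *)
Lemma bochner_algebra :
  \sum_i \sum_a (dA i i a * V a + A i a * dV i a)
    + \sum_i \sum_l G i i l * (\sum_a A l a * V a) =
  \sum_l V l * (\sum_i dA l i i)
    + \sum_j \sum_k (\sum_i Rm i i j k) * (V j * V k)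
    + \sum_i \sum_s A i s * A s i.
Proof.
have e0 : \sum_i \sum_l G i i l * (\sum_a A l a * V a) =
    \sum_i \sum_a (\sum_l G i i l * A l a) * V a.
  apply: eq_bigr => i _; under eq_bigr do rewrite mulr_sumr.
  rewrite exchange_big /=; apply: eq_bigr => a _.
  by rewrite mulr_suml; apply: eq_bigr => l _; rewrite mulrA.
have e1 : \sum_i \sum_a (dA i i a * V a + A i a * dV i a) =
    \sum_i \sum_a dA i i a * V a + \sum_i \sum_a A i a * dV i a.
  by rewrite -big_split; apply: eq_bigr => i _; rewrite big_split.
have e2 : \sum_i \sum_a dA i i a * V a + \sum_i \sum_a (\sum_l G i i l * A l a) * V a =
    \sum_i \sum_a dA a i i * V a + \sum_i \sum_a (\sum_s G i a s * A s i) * V a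
    + \sum_i \sum_a (\sum_k Rm i i a k * V k) * V a.
  rewrite -!big_split /=; apply: eq_bigr => i _.
  rewrite -!big_split /=; apply: eq_bigr => a _.
  by rewrite -!mulrDl ricci_identity.
(* Completing [dV i a] to [A a i] costs a Christoffel term; by [e4] it cancels the one that the
   Ricci identity left in [e2]. *)
have e3 : \sum_i \sum_a A i a * dV i a =
    \sum_i \sum_s A i s * A s i - \sum_i \sum_a A i a * (\sum_k G a i k * V k).
  rewrite -sumrB; apply: eq_bigr => i _; rewrite -sumrB; apply: eq_bigr => a _.
  by rewrite -mulrBr addrK.
have e4 : \sum_i \sum_a A i a * (\sum_k G a i k * V k) =
    \sum_i \sum_a (\sum_s G i a s * A s i) * V a.
  rewrite exchange_big /=; apply: eq_bigr => i _.
  under eq_bigr do rewrite mulr_sumr.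
  rewrite exchange_big /=; apply: eq_bigr => a _.
  by rewrite mulr_suml; apply: eq_bigr => s _; rewrite (G_sym i s a); ring.
have e5 : \sum_i \sum_a dA a i i * V a = \sum_l V l * (\sum_i dA l i i).
  rewrite exchange_big /=; apply: eq_bigr => a _.
  by rewrite mulr_sumr; apply: eq_bigr => i _; rewrite mulrC.
have e6 : \sum_i \sum_a (\sum_k Rm i i a k * V k) * V a =
    \sum_j \sum_k (\sum_i Rm i i j k) * (V j * V k).
  rewrite exchange_big /=; apply: eq_bigr => a _.
  under eq_bigr do rewrite mulr_suml.
  rewrite exchange_big /=; apply: eq_bigr => k _.
  by rewrite mulr_suml; apply: eq_bigr => i _; ring.
rewrite e0 e1 addrAC e2 e3 e4 e5 e6; ring.
Qed.

End BochnerAlgebra.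

(** * Gradient, Hessian and Laplacian in a chart *)

Section RiemannianCalculus.
Variables (R : realType) (n : nat) (D : set 'rV[R]_n).
Hypothesis D_open : open D.
Variable g : 'rV[R]_n -> 'M[R]_n.
Hypothesis g_smooth : forall i j, smooth_on D (fun y => g y i j).
Hypothesis g_sym : forall x, D x -> (g x)^T = g x.
Hypothesis g_posdef : forall x, D x -> posdef (g x).
Implicit Types (f : 'rV[R]_n -> R) (x : 'rV[R]_n).

Lemma smooth_partialM i f1 f2 x : smooth_on D f1 -> smooth_on D f2 -> D x ->
  partial i (fun y => f1 y * f2 y) x =
  f1 x * partial i f2 x + f2 x * partial i f1 x.
Proof. by move=> s1 s2 Dx; apply: partialM; apply: smooth_diff Dx. Qed.

Lemma smooth_partial_sum i (I : Type) (s : seq I) (F : I -> 'rV[R]_n -> R) x :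
  (forall j, smooth_on D (F j)) -> D x ->
  partial i (fun y => \sum_(j <- s) F j y) x = \sum_(j <- s) partial i (F j) x.
Proof.
move=> sF Dx; have dF j : differentiable (F j) x by apply: smooth_diff Dx.
by have [] := partial_sum i s dF.
Qed.

Lemma smooth_partialC i j f x : smooth_on D f -> D x ->
  partial i (partial j f) x = partial j (partial i f) x.
Proof.
move=> sf Dx; apply: derive_comm.
- have := open_nbhs_nbhs (conj D_open Dx).
  by apply: filterS => y Dy; exact: (smooth_diff sf).
- by apply: (smooth_diff (smooth_partial i sf)).
- by apply: (smooth_diff (smooth_partial j sf)).
Qed.

Lemma metric_entry_sym x i j : D x -> g x i j = g x j i.
Proof. by move=> Dx; rewrite -{1}(g_sym Dx) mxE. Qed.

Lemma partial_metric_sym x k i j : D x ->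
  partial k (fun y => g y i j) x = partial k (fun y => g y j i) x.
Proof.
move=> Dx; apply: (eq_on_partial D_open); last by rewrite inE.
by move=> y; rewrite inE => Dy; exact: metric_entry_sym.
Qed.

Lemma smooth_cometric i j : smooth_on D (fun y => invmx (g y) i j).
Proof.
by apply: smooth_invmx => // x Dx; apply: posdef_unitmx; exact: g_posdef.
Qed.

Lemma cometric_sym x i j : D x -> invmx (g x) i j = invmx (g x) j i.
Proof.
move=> Dx; have [sV _] := posdef_invmx (g_sym Dx) (g_posdef Dx).
by rewrite -{1}sV mxE.
Qed.

Lemma christoffel_sym x k i j : D x -> christoffel g k i j x = christoffel g k j i x.
Proof.
move=> Dx; rewrite /christoffel; congr (_ * _); apply: eq_bigr => l _.
by rewrite (partial_metric_sym l i j Dx); congr (_ * _); ring.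
Qed.

Lemma smooth_christoffel k i j : smooth_on D (christoffel g k i j).
Proof.
apply: smoothM => //; first exact: smooth_cst.
apply: smooth_sum => // l; apply: smoothM => //; first exact: smooth_cometric.
apply: smoothD => //; last by apply: smoothN => //; exact: smooth_partial.
by apply: smoothD => //; exact: smooth_partial.
Qed.

(* christoffel1 l i j = Gamma_{l,ij}, the symbols of the first kind. *)
Definition christoffel1 (l i j : 'I_n) x : R :=
  2^-1 * (partial i (fun y => g y j l) x + partial j (fun y => g y i l) x
          - partial l (fun y => g y i j) x).

Lemma christoffelE k i j x :
  christoffel g k i j x = \sum_l invmx (g x) k l * christoffel1 l i j x.
Proof.
rewrite /christoffel mulr_sumr; apply: eq_bigr => l _.
by rewrite /christoffel1 mulrCA.
Qed.

Lemma christoffel_lower a i j x : D x ->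
  \sum_k g x a k * christoffel g k i j x = christoffel1 a i j x.
Proof.
move=> Dx; have uA := posdef_unitmx (g_posdef Dx).
have /matrixP/(_ a 0) := mulKVmx uA (\col_l christoffel1 l i j x).
rewrite !mxE => <-; apply: eq_bigr => k _; rewrite mxE christoffelE.
by congr (_ * _); apply: eq_bigr => l _; rewrite mxE.
Qed.

(** The metric is parallel: nabla g = 0, written with symbols of the first kind. *)
Lemma metric_compatibility a i l x : D x ->
  christoffel1 a i l x + christoffel1 l a i x = partial i (fun y => g y a l) x.
Proof.
move=> Dx; rewrite /christoffel1.
rewrite (partial_metric_sym i l a Dx) (partial_metric_sym l i a Dx).
by field.
Qed.

Definition gradient f (k : 'I_n) x : R := \sum_l invmx (g x) k l * partial l f x.

(* hessian1 f k i = nabla_i V^k, where V = grad f. *)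
Definition hessian1 f (k i : 'I_n) x : R :=
  partial i (gradient f k) x + \sum_l christoffel g k i l x * gradient f l x.

Lemma smooth_gradient f k : smooth_on D f -> smooth_on D (gradient f k).
Proof.
move=> sf; apply: smooth_sum => // l.
by apply: smoothM => //; [exact: smooth_cometric|exact: smooth_partial].
Qed.

Lemma smooth_hessian1 f k i : smooth_on D f -> smooth_on D (hessian1 f k i).
Proof.
move=> sf; apply: smoothD => //.
  by apply: smooth_partial; exact: smooth_gradient.
apply: smooth_sum => // l.
by apply: smoothM => //; [exact: smooth_christoffel|exact: smooth_gradient].
Qed.

Lemma gradient_lower f a x : D x ->
  \sum_k g x a k * gradient f k x = partial a f x.
Proof.
move=> Dx; have uA := posdef_unitmx (g_posdef Dx).
have /matrixP/(_ a 0) := mulKVmx uA (\col_l partial l f x).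
rewrite !mxE => <-; apply: eq_bigr => k _; rewrite mxE.
by congr (_ * _); apply: eq_bigr => l _; rewrite mxE.
Qed.

Lemma hessian_sym f x : smooth_on D f -> D x -> (hessian g f x)^T = hessian g f x.
Proof.
move=> sf Dx; apply/matrixP => i j; rewrite !mxE (smooth_partialC j i sf Dx).
by congr (_ - _); apply: eq_bigr => k _; rewrite (christoffel_sym k j i Dx).
Qed.

(** Lowering an index commutes with covariant differentiation because the metric is parallel:
    differentiating [gradient_lower] produces a derivative of the metric, which
    [metric_compatibility] splits into two Christoffel terms. *)
Lemma hessian1_lower f a i x : smooth_on D f -> D x ->
  \sum_k g x a k * hessian1 f k i x = hessian g f x a i.
Proof.
move=> sf Dx.
have dlow : \sum_k (g x a k * partial i (gradient f k) x +
    gradient f k x * partial i (fun y => g y a k) x) = partial i (partial a f) x.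
  have /(eq_on_partial D_open i) := fun y (Dy : y \in D) => gradient_lower f a (set_mem Dy).
  move=> /(_ x (mem_set Dx)) <-; rewrite smooth_partial_sum //; last first.
    by move=> k; apply: smoothM => //; exact: smooth_gradient.
  by apply: eq_bigr => k _; rewrite smooth_partialM //; exact: smooth_gradient.
have chr : \sum_k christoffel g k a i x * partial k f x =
    \sum_l christoffel1 l a i x * gradient f l x.
  under eq_bigr do rewrite christoffelE mulr_suml.
  rewrite exchange_big /=; apply: eq_bigr => l _.
  rewrite /gradient mulr_sumr; apply: eq_bigr => k _.
  by rewrite (cometric_sym l k Dx); ring.
have chr2 : \sum_k g x a k * (\sum_l christoffel g k i l x * gradient f l x) =
    \sum_l christoffel1 a i l x * gradient f l x.
  under eq_bigr do rewrite mulr_sumr.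
  rewrite exchange_big /=; apply: eq_bigr => l _.
  rewrite -(christoffel_lower a i l Dx) mulr_suml; apply: eq_bigr => k _; ring.
rewrite mxE (smooth_partialC a i sf Dx) -dlow chr.
under eq_bigr do rewrite mulrDr.
rewrite !big_split /= chr2 -addrA; congr (_ + _).
apply/eqP; rewrite eq_sym subr_eq -big_split /=; apply/eqP/eq_bigr => l _.
by rewrite -mulrDl metric_compatibility // mulrC.
Qed.

Lemma hessian1E f x : smooth_on D f -> D x ->
  \matrix_(k, i) hessian1 f k i x = invmx (g x) *m hessian g f x.
Proof.
move=> sf Dx; have uA := posdef_unitmx (g_posdef Dx).
rewrite -[LHS](mulKmx uA); congr (_ *m _); apply/matrixP => a i.
rewrite mxE -(hessian1_lower a i sf Dx); by apply: eq_bigr => k _; rewrite mxE.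
Qed.

Lemma laplacianE f x : smooth_on D f -> D x ->
  laplacian g f x = \sum_i hessian1 f i i x.
Proof.
move=> sf Dx; rewrite /laplacian /metric_trace; apply: eq_bigr => i _.
have /matrixP/(_ i i) := hessian1E sf Dx; rewrite mxE => ->.
rewrite mxE; apply: eq_bigr => j _; congr (_ * _).
by rewrite -{1}hessian_sym // mxE.
Qed.

Lemma smooth_laplacian f : smooth_on D f -> smooth_on D (laplacian g f).
Proof.
move=> sf; apply: (@smooth_ext _ _ _ D_open (fun x => \sum_i hessian1 f i i x)).
  by move=> x; rewrite inE => Dx; rewrite laplacianE.
by apply: smooth_sum => // i; exact: smooth_hessian1.
Qed.

Lemma grad_sqnormE f x : grad_sqnorm g f x = \sum_k gradient f k x * partial k f x.
Proof.
apply: eq_bigr => i _; rewrite /gradient mulr_suml; apply: eq_bigr => j _.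
by rewrite -mulrA (mulrC (partial j f x)).
Qed.

Lemma smooth_grad_sqnorm f : smooth_on D f -> smooth_on D (grad_sqnorm g f).
Proof.
move=> sf; rewrite (funext (grad_sqnormE f)); apply: smooth_sum => // k.
by apply: smoothM => //; [exact: smooth_gradient|exact: smooth_partial].
Qed.

(** In the sum of V^k d_k f, with V = grad f, differentiating either factor gives the same Hessian
    contraction up to a Christoffel term; by [e2] these two terms cancel. *)
Lemma partial_grad_sqnorm f i x : smooth_on D f -> D x ->
  partial i (grad_sqnorm g f) x = 2 * \sum_a hessian g f x a i * gradient f a x.
Proof.
move=> sf Dx; rewrite (funext (grad_sqnormE f)).
have sV k : smooth_on D (gradient f k) by exact: smooth_gradient.
have sp k : smooth_on D (partial k f) by exact: smooth_partial.
rewrite smooth_partial_sum //; last by move=> k; apply: smoothM.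
under eq_bigr do rewrite smooth_partialM //.
have e1 : \sum_k partial k f x * hessian1 f k i x =
    \sum_a hessian g f x a i * gradient f a x.
  under eq_bigr => k _ do rewrite -(gradient_lower f k Dx) mulr_suml.
  rewrite exchange_big /=; apply: eq_bigr => a _.
  rewrite -(hessian1_lower _ _ sf Dx) mulr_suml; apply: eq_bigr => k _.
  by rewrite (metric_entry_sym k a Dx); ring.
have e2 : \sum_k gradient f k x * (\sum_l christoffel g l k i x * partial l f x) =
    \sum_k partial k f x * (\sum_l christoffel g k i l x * gradient f l x).
  under eq_bigr do rewrite mulr_sumr.
  rewrite exchange_big /=; apply: eq_bigr => l _.
  rewrite mulr_sumr; apply: eq_bigr => k _.
  by rewrite (christoffel_sym l k i Dx); ring.
have e3 : \sum_k gradient f k x * hessian g f x k i =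
    \sum_k gradient f k x * partial i (partial k f) x
    - \sum_k gradient f k x * (\sum_l christoffel g l k i x * partial l f x).
  rewrite -sumrB; apply: eq_bigr => k _; rewrite mxE -mulrBr.
  by rewrite (smooth_partialC k i sf Dx).
have e4 : \sum_k partial k f x * hessian1 f k i x =
    \sum_k partial k f x * partial i (gradient f k) x
    + \sum_k partial k f x * (\sum_l christoffel g k i l x * gradient f l x).
  by rewrite -big_split /=; apply: eq_bigr => k _; rewrite -mulrDr.
rewrite big_split /= mulr_natl mulr2n -{1}e1 e4.
under [X in _ = _ + X]eq_bigr do rewrite mulrC.
by rewrite e3 e2; ring.
Qed.

Lemma gradient_grad_sqnorm f i x : smooth_on D f -> D x ->
  gradient (grad_sqnorm g f) i x = 2 * \sum_a hessian1 f i a x * gradient f a x.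
Proof.
move=> sf Dx; rewrite /gradient.
under eq_bigr => l _ do rewrite partial_grad_sqnorm // mulrCA mulr_sumr.
rewrite -mulr_sumr exchange_big /=; congr (_ * _); apply: eq_bigr => a _.
have /matrixP/(_ i a) := hessian1E sf Dx; rewrite mxE => ->.
rewrite mxE mulr_suml; apply: eq_bigr => l _; rewrite mulrA.
by rewrite -{1}(hessian_sym sf Dx) mxE.
Qed.

(** By [gradient_grad_sqnorm], half the Laplacian of |grad f|^2 is the divergence treated in
    [bochner_algebra], taken for V = grad f. *)
Lemma bochner f x : smooth_on D f -> D x ->
  2^-1 * laplacian g (grad_sqnorm g f) x =
  \sum_l gradient f l x * partial l (laplacian g f) x
  + \sum_j \sum_k ricci g x j k * (gradient f j x * gradient f k x)
  + \tr (invmx (g x) *m hessian g f x *m (invmx (g x) *m hessian g f x)).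
Proof.
move=> sf Dx.
have sV k : smooth_on D (gradient f k) by exact: smooth_gradient.
have sH k i : smooth_on D (hessian1 f k i) by exact: smooth_hessian1.
have sG k i j : smooth_on D (christoffel g k i j) by exact: smooth_christoffel.
have dH i l j : partial i (hessian1 f l j) x = partial i (partial j (gradient f l)) x
    + \sum_k (partial i (christoffel g l j k) x * gradient f k x
       + christoffel g l j k x * partial i (gradient f k) x).
  rewrite partialD.
  - congr (_ + _); rewrite smooth_partial_sum //; last by move=> k; apply: smoothM.
    by apply: eq_bigr => k _; rewrite smooth_partialM //; ring.
  - by apply: (smooth_diff _ Dx); exact: smooth_partial.
  - by apply: (smooth_diff _ Dx); apply: smooth_sum => // k; exact: smoothM.
rewrite laplacianE //; last exact: smooth_grad_sqnorm.
have dHV i : hessian1 (grad_sqnorm g f) i i x = 2 * (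
    \sum_a (partial i (hessian1 f i a) x * gradient f a x
            + hessian1 f i a x * partial i (gradient f a) x)
    + \sum_l christoffel g i i l x * (\sum_a hessian1 f l a x * gradient f a x)).
  rewrite [LHS]/hessian1 mulrDr; congr (_ + _).
    have /(eq_on_partial D_open i) :=
      fun y (Dy : y \in D) => gradient_grad_sqnorm i sf (set_mem Dy).
    move=> /(_ x (mem_set Dx)) ->.
    rewrite smooth_partialM //; [|exact: smooth_cst|]; last first.
      by apply: smooth_sum => // a; exact: smoothM.
    rewrite partial_cst mulr0 addr0; congr (_ * _).
    rewrite smooth_partial_sum //; last by move=> a; exact: smoothM.
    by apply: eq_bigr => a _; rewrite smooth_partialM //; ring.
  rewrite mulr_sumr; apply: eq_bigr => l _.
  by rewrite gradient_grad_sqnorm //; ring.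
under eq_bigr do rewrite dHV.
rewrite -mulr_sumr mulKf // big_split /=.
under eq_bigr => i _ do under eq_bigr => a _ do rewrite dH.
have -> : \tr (invmx (g x) *m hessian g f x *m (invmx (g x) *m hessian g f x)) =
    \sum_i \sum_s hessian1 f i s x * hessian1 f s i x.
  rewrite -hessian1E //; apply: eq_bigr => i _; rewrite mxE.
  by apply: eq_bigr => s _; rewrite !mxE.
have -> : \sum_l gradient f l x * partial l (laplacian g f) x =
    \sum_l gradient f l x * (\sum_i partial l (hessian1 f i i) x).
  apply: eq_bigr => l _; congr (_ * _).
  have /(eq_on_partial D_open l) := fun y (Dy : y \in D) => laplacianE sf (set_mem Dy).
  by move=> /(_ x (mem_set Dx)) ->; rewrite smooth_partial_sum.
have -> : \sum_j \sum_k ricci g x j k * (gradient f j x * gradient f k x) =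
    \sum_j \sum_k (\sum_i riemann g i i j k x) * (gradient f j x * gradient f k x).
  by apply: eq_bigr => j _; apply: eq_bigr => k _; rewrite mxE.
under [in RHS]eq_bigr => l _ do under [X in _ * X]eq_bigr => i _ do rewrite dH.
apply: (@bochner_algebra _ _ (gradient f ^~ x) (fun i l => partial i (gradient f l) x)
  (fun i j l => partial i (partial j (gradient f l)) x)
  (fun l i j => christoffel g l i j x)
  (fun i l j k => partial i (christoffel g l j k) x)).
- by move=> i j l; exact: smooth_partialC.
- by move=> l i j; exact: christoffel_sym.
Qed.

End RiemannianCalculus.

(** * Gradient and Laplacian of composite functions, maxima *)

Lemma partial_comp (R : realType) n (F : R -> R) (dF : R) i (u : 'rV[R]_n -> R) x :
  is_derive (u x) 1 F dF -> differentiable u x ->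
  partial i (fun y => F (u y)) x = dF * partial i u x.
Proof.
move=> [dvF <-] du.
have dFu : differentiable F (u x) by apply/derivable1_diffP.
rewrite /partial [LHS]deriveE; last exact: (differentiable_comp du dFu).
rewrite (diff_comp du dFu) /= deriveE // deriveE // mulrC.
set t := 'd u x _.
by rewrite -[t in LHS]mulr1 -[t * 1]/(t *: (1 : R)) linearZ.
Qed.

Section LaplacianRules.
Variables (R : realType) (n : nat) (D : set 'rV[R]_n).
Hypothesis D_open : open D.
Variable g : 'rV[R]_n -> 'M[R]_n.
Hypothesis g_sym : forall x, D x -> (g x)^T = g x.
Hypothesis g_posdef : forall x, D x -> posdef (g x).
Implicit Types (f u : 'rV[R]_n -> R) (x : 'rV[R]_n).

Lemma laplacianB f1 f2 x : smooth_on D f1 -> smooth_on D f2 -> D x ->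
  laplacian g (fun y => f1 y - f2 y) x = laplacian g f1 x - laplacian g f2 x.
Proof.
move=> s1 s2 Dx.
have pB i : {in D, partial i (fun y => f1 y - f2 y) =1
    (fun y => partial i f1 y - partial i f2 y)}.
  move=> y; rewrite inE => Dy; rewrite partialD ?partialN //.
  - by apply: smooth_diff Dy.
  - by apply: smooth_diff Dy.
  - by apply: differentiableN; apply: smooth_diff Dy.
rewrite /laplacian /metric_trace -sumrB; apply: eq_bigr => i _.
rewrite -sumrB; apply: eq_bigr => j _; rewrite -mulrBr; congr (_ * _).
rewrite !mxE (eq_on_partial D_open i (pB j)) ?inE //.
have -> : partial i (fun y => partial j f1 y - partial j f2 y) x =
    partial i (partial j f1) x - partial i (partial j f2) x.
  rewrite partialD ?partialN //.
  - by apply: (smooth_diff _ Dx); exact: smooth_partial.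
  - by apply: (smooth_diff _ Dx); exact: smooth_partial.
  - by apply: differentiableN; apply: (smooth_diff _ Dx); exact: smooth_partial.
rewrite [X in _ - X](_ : _ = \sum_k christoffel g k i j x * partial k f1 x -
    \sum_k christoffel g k i j x * partial k f2 x).
  have subrACA (a b c d : R) : a - b - (c - d) = a - c - (b - d) by ring.
  exact: subrACA.
by rewrite -sumrB; apply: eq_bigr => k _; rewrite pB ?inE // mulrBr.
Qed.

Lemma laplacian_cst (a : R) x : laplacian g (fun=> a) x = 0.
Proof.
have p0 i : partial i (fun=> a : R) = fun=> 0.
  by apply/funext => y; exact: partial_cst.
rewrite /laplacian /metric_trace big1 // => i _; rewrite big1 // => j _.
rewrite mxE !p0 partial_cst big1 ?subr0 ?mulr0 // => l _.
by rewrite p0 mulr0.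
Qed.

(** Derivatives of [F] and [F1] are asked for only at values of [u], so that the rule covers the
    logarithm of a positive function. *)
Lemma laplacian_comp (F F1 : R -> R) (F2 : R) u x :
  (forall y, D y -> is_derive (u y) 1 F (F1 (u y))) -> is_derive (u x) 1 F1 F2 ->
  smooth_on D u -> D x ->
  laplacian g (fun y => F (u y)) x =
  F1 (u x) * laplacian g u x + F2 * grad_sqnorm g u x.
Proof.
move=> dF dF1 su Dx.
have pF i : {in D, partial i (fun y => F (u y)) =1 (fun y => F1 (u y) * partial i u y)}.
  move=> y; rewrite inE => Dy; rewrite (partial_comp i (dF y Dy)) //.
  exact: (smooth_diff su).
rewrite /laplacian /grad_sqnorm /metric_trace !mulr_sumr -big_split /=.
apply: eq_bigr => i _; rewrite !mulr_sumr -big_split /=; apply: eq_bigr => j _.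
rewrite !mxE (eq_on_partial D_open i (pF j)) ?inE // partialM.
- rewrite (partial_comp i dF1) //; last exact: (smooth_diff su).
  rewrite [X in _ - X](_ : _ = F1 (u x) * \sum_k christoffel g k i j x * partial k u x).
    have eqr (h a b c d e S : R) : h * (a * b + c * (e * d) - a * S) =
        a * (h * (b - S)) + e * (h * (d * c)) by ring.
    exact: eqr.
  rewrite mulr_sumr; apply: eq_bigr => k _; rewrite pF ?inE //; ring.
- apply: (@differentiable_comp _ _ _ _ u F1); first exact: (smooth_diff su).
  by apply/derivable1_diffP; case: dF1.
- by apply: (smooth_diff _ Dx); exact: smooth_partial.
Qed.

Lemma grad_sqnorm_comp (F : R -> R) (dF : R) u x :
  is_derive (u x) 1 F dF -> differentiable u x ->
  grad_sqnorm g (fun y => F (u y)) x = dF ^+ 2 * grad_sqnorm g u x.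
Proof.
move=> hF du; rewrite /grad_sqnorm mulr_sumr; apply: eq_bigr => i _.
rewrite mulr_sumr; apply: eq_bigr => j _.
rewrite !(partial_comp _ hF du).
have eqr (h c a b : R) : h * (c * a * (c * b)) = c ^+ 2 * (h * (a * b)) by ring.
exact: eqr.
Qed.

Lemma grad_sqnorm_ge0 f x : D x -> 0 <= grad_sqnorm g f x.
Proof.
move=> Dx; have [sV pV] := posdef_invmx (g_sym Dx) (g_posdef Dx).
have -> : grad_sqnorm g f x =
    ((\row_i partial i f x) *m invmx (g x) *m (\row_i partial i f x)^T) 0 0.
  rewrite /grad_sqnorm mxE exchange_big; apply: eq_bigr => j _ /=.
  rewrite !mxE mulr_suml; apply: eq_bigr => i _; rewrite !mxE.
  by rewrite mulrA [_ * partial i f x]mulrC.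
by have [->|/pV/ltW//] := eqVneq (\row_i partial i f x) 0; rewrite !mul0mx mxE.
Qed.

(** At a critical point the Christoffel part of the Hessian vanishes, so its quadratic form at [v]
    is the second derivative of [f] along [v], which is nonpositive at a maximum. *)
Lemma local_max_laplacian f x : smooth_on D f -> D x ->
  (forall y, D y -> f y <= f x) ->
  (forall i, partial i f x = 0) /\ laplacian g f x <= 0.
Proof.
move=> sf Dx fmax; have nD := open_nbhs_nbhs (conj D_open Dx).
have ndf : \forall y \near x, differentiable f y.
  by apply: filterS nD => y Dy; exact: (smooth_diff sf).
have nmax : \forall y \near x, f y <= f x by apply: filterS nD => y; exact: fmax.
have p0 i : partial i f x = 0 by have [] := derive_local_max (delta_mx 0 i) ndf nmax.
split=> //; have [sV pV] := posdef_invmx (g_sym Dx) (g_posdef Dx).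
apply: trace_posdef_le0 => // v.
have [_] := derive_local_max v ndf nmax.
have vE : {in D, 'D_v f =1 (fun y => \sum_j v 0 j * partial j f y)}.
  move=> y; rewrite inE => Dy; rewrite derive_partial //; exact: (smooth_diff sf).
have s1 : smooth_on D (fun y => \sum_j v 0 j * partial j f y).
  apply: smooth_sum => // j; apply: smoothM => //; first exact: smooth_cst.
  exact: smooth_partial.
have d1 : differentiable ('D_v f) x.
  apply: near_eq_differentiable (smooth_diff s1 Dx).
  by apply: (eq_on_near D_open Dx) => y Dy; rewrite vE.
move=> /(_ d1); apply: le_trans; rewrite derive_partial //.
rewrite le_eqVlt; apply/orP; left; apply/eqP/eq_bigr => i _.
have /(eq_on_partial D_open i)/(_ x (mem_set Dx)) -> := vE.
rewrite (@smooth_partial_sum _ _ D) //; last first.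
  move=> j; apply: smoothM => //; first exact: smooth_cst.
  exact: smooth_partial.
rewrite mulr_sumr; apply: eq_bigr => j _.
rewrite (@smooth_partialM _ _ D) //; [|exact: smooth_cst|exact: smooth_partial].
rewrite partial_cst mulr0 addr0 mxE.
rewrite [X in _ - X]big1 ?subr0 ?mulrA // => k _.
by rewrite p0 mulr0.
Qed.

End LaplacianRules.

(** * The maximum principle in a chart *)

(* What the first and second order conditions at a maximum of F / u^2 + eps u^p
   (with value Y) amount to, where F = G + lambda / N and G = |grad u|^2. There
   F - f(u) has a local maximum for f(s) = Y s^2 - eps s^(p+2); a = f'(u) and
   b = f''(u). Moreover e = eps u^p, L = Lap u, LG = Lap G,
   v = <grad u, grad L> and t = |Hess u|^2. *)
Lemma critical_point_contradiction (R : realType) (m mu lambda n u L G LG v t Y e p : R) :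
  let N := m + n - 1 in let k := 2 - m - n in
  let a := u * (2 * Y - (p + 2) * e) in
  let b := 2 * Y - (p + 2) * (p + 1) * e in
  1 < m -> 0 < n -> 0 < u -> 0 <= G -> 0 < e -> 0 <= p ->
  N <= p -> 2 * (m - 1) <= n * p -> N * e < n * (mu / (m - 1)) ->
  mu / (m - 1) < Y ->
  G + lambda / N = (Y - e) * u ^+ 2 ->
  u * L = lambda + N * G - mu * u ^+ 2 ->
  LG <= b * G + a * L ->
  2^-1 * LG = v + (mu * G + k / u * (2^-1 * (a * G))) + t ->
  u * v + G * L = N * (a * G) - 2 * mu * u * G ->
  L ^+ 2 <= n * t -> False.
Proof.
move=> N k a b m1 n0 u0 G0 e0 p0 Np mp eN Yb FE LE maxL boch dLE csL.
have m10 : 0 < m - 1 by lra.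
have N0 : 0 < N by rewrite /N; lra.
pose y := N * (Y - e) - mu.
have LyE : L = y * u.
  apply: (mulfI (lt0r_neq0 u0)); rewrite LE.
  have -> : lambda = N * ((Y - e) * u ^+ 2 - G) by rewrite -FE; field; lra.
  rewrite /y; ring.
have muE : mu / (m - 1) * (m - 1) = mu by rewrite divfK // lt0r_neq0.
(* Since N = (m-1) + n, N mu / (m-1) exceeds mu by exactly n mu / (m-1), which is the bound imposed
   on N e. *)
have y0 : 0 < y.
  have h : N * (mu / (m - 1)) < N * Y by rewrite ltr_pM2l.
  have h2 : N * (mu / (m - 1)) = mu / (m - 1) * (m - 1) + n * (mu / (m - 1)).
    by rewrite /N; ring.
  rewrite /y mulrBr; move: eN h; rewrite h2 muE; lra.
pose a' := 2 * Y - (p + 2) * e.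
have vE : v = N * a' * G - 2 * mu * G - G * y.
  apply: (mulfI (lt0r_neq0 u0)).
  have -> : u * v = N * (a * G) - 2 * mu * u * G - G * L by rewrite -dLE; ring.
  by rewrite LyE /a -/a'; ring.
have kE : k / u * (2^-1 * (a * G)) = k * a' * G / 2.
  by rewrite /a -/a'; field; exact: lt0r_neq0.
move: boch; rewrite vE kE => boch.
have LGE : LG = 2 * N * a' * G - 2 * mu * G - 2 * G * y + k * a' * G + 2 * t.
  have -> : LG = 2 * (2^-1 * LG) by field.
  by rewrite boch; field.
have tL : y ^+ 2 * u ^+ 2 <= n * t by rewrite -exprMn -LyE.
have key : 0 <= y * (n * a' - 2 * y) * u ^+ 2.
  have h1 : 0 <= n * (b * G + a * L - LG) by rewrite mulr_ge0 ?subr_ge0 // ltW.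
  (* In the coefficient of [G] the terms in [Y] cancel because 2 N + k = N + 1; only - e p (p + 2 -
     N) survives, and [N <= p] fixes its sign. *)
  have h2 : n * (b * G + a * L - LG) = y * (n * a' - 2 * y) * u ^+ 2
      - n * (e * (p * (p + 2 - N)) * G) - 2 * (n * t - y ^+ 2 * u ^+ 2).
    by rewrite LGE LyE /a /b /k /a' /y /N; ring.
  have h3 : 0 <= n * (e * (p * (p + 2 - N)) * G).
    have pN : 0 <= p + 2 - N by rewrite addrAC addr_ge0 // subr_ge0.
    have pp := mulr_ge0 p0 pN.
    exact: mulr_ge0 (ltW n0) (mulr_ge0 (mulr_ge0 (ltW e0) pp) G0).
  have lin (A B C T : R) : 0 <= A - B - 2 * (T - C) -> C <= T -> 0 <= B -> 0 <= A.
    by lra.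
  by rewrite h2 in h1; exact: lin h1 tL h3.
rewrite pmulr_lge0 ?exprn_gt0 // pmulr_rge0 // in key.
have Ym : mu < Y * (m - 1) by rewrite -ltr_pdivrMr.
have en : 0 <= e * (n * p - 2 * (m - 1)) by rewrite mulr_ge0 ?subr_ge0 // ltW.
have : n * a' - 2 * y = 2 * (mu - Y * (m - 1)) - e * (n * p - 2 * (m - 1)).
  by rewrite /a' /y /N; ring.
move=> h; move: key en Ym; rewrite h; set A := e * _; set B := Y * _.
by clear; lra.
Qed.

Section LocalContradiction.
Variables (R : realType) (n : nat) (D : set 'rV[R]_n).
Hypothesis D_open : open D.
Variable g : 'rV[R]_n -> 'M[R]_n.
Hypothesis g_smooth : forall i j, smooth_on D (fun y => g y i j).
Hypothesis g_sym : forall x, D x -> (g x)^T = g x.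
Hypothesis g_posdef : forall x, D x -> posdef (g x).
Variables (m mu lambda : R).
Let N := m + n%:R - 1.
Let k := 2 - m - n%:R.
Variable u : 'rV[R]_n -> R.
Hypothesis u_smooth : smooth_on D u.
Hypothesis u_gt0 : forall x, D x -> 0 < u x.
Hypothesis u_qe : forall x, D x ->
  ricci g x - (k * (u x)^-1) *: hessian g u x = mu *: g x.
Hypothesis u_laplacian : forall x, D x ->
  u x * laplacian g u x = lambda + N * grad_sqnorm g u x - mu * u x ^+ 2.

Lemma no_local_max (eps : R) (p : nat) x : (0 < n)%N -> 1 < m -> 0 < eps ->
  N <= p%:R -> 2 * (m - 1) <= n%:R * p%:R ->
  N * (eps * u x ^+ p) < n%:R * (mu / (m - 1)) -> D x ->
  let W y := (grad_sqnorm g u y + lambda / N) / u y ^+ 2 + eps * u y ^+ p in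
  mu / (m - 1) < W x -> (forall y, D y -> W y <= W x) -> False.
Proof.
move=> n0 m1 e0 Np mp eN Dx W Wx Wmax.
(* [F] is the function f of the comment above with Y = [W x], not |grad u|^2 + lambda / N. *)
pose F t : R := W x * t ^+ 2 - eps * t ^+ p.+2.
pose F1 t : R := W x * (2 * t) - eps * (p.+2%:R * t ^+ p.+1).
pose F2 t : R := W x * 2 - eps * (p.+2%:R * (p.+1%:R * t ^+ p)).
have dX (q : nat) (t : R) :
    is_derive t (1 : R) (fun s : R => s ^+ q.+1) (q.+1%:R * t ^+ q).
  apply: DeriveDef; first exact: exprn_derivable.
  by rewrite exp_derive [_ *: 1]mulr1.
have dF (t : R) : is_derive t (1 : R) F (F1 t).
  have h := is_deriveB (is_deriveZ (W x) (dX 1 t)) (is_deriveZ eps (dX p.+1 t)).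
  by apply: is_derive_eq h _; rewrite expr1.
have dF1 (t : R) : is_derive t (1 : R) F1 (F2 t).
  have h := is_deriveB (is_deriveZ (W x) (is_deriveZ 2 (dX 0%N t)))
    (is_deriveZ eps (is_deriveZ p.+2%:R (dX p t))).
  by apply: is_derive_eq h _; rewrite expr0 mulr1 /F2 /GRing.scale /= mulr1.
have sG := smooth_grad_sqnorm D_open g_smooth g_posdef u_smooth.
have sL := smooth_laplacian D_open g_smooth g_sym g_posdef u_smooth.
have su2 q : smooth_on D (fun y => u y ^+ q) by exact: smoothX.
have sF : smooth_on D (fun y => F (u y)).
  apply: smoothD => //; first by apply: smoothM => //; exact: smooth_cst.
  by apply: smoothN => //; apply: smoothM => //; exact: smooth_cst.
have sF' : smooth_on D (fun y => F (u y) - lambda / N).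
  by apply: smoothD => //; exact: smooth_cst.
(* Multiplying [W y - W x] by u^2 keeps a maximum at [x], of value 0, and spares differentiating a
   quotient. *)
pose Z y := grad_sqnorm g u y - (F (u y) - lambda / N).
have sZ : smooth_on D Z by apply: smoothD => //; exact: smoothN.
have ZE y : D y -> Z y = (W y - W x) * u y ^+ 2.
  move=> Dy; have uy := lt0r_neq0 (u_gt0 Dy).
  rewrite /Z /F {2}/W; move: (W x) => w.
  have -> : u y ^+ p.+2 = u y ^+ p * u y ^+ 2 by rewrite -exprD addn2.
  by rewrite mulrBl mulrDl divfK ?expf_neq0 //; ring.
have Zx : Z x = 0 by rewrite ZE // subrr mul0r.
have Zmax y : D y -> Z y <= Z x.
  move=> Dy; rewrite Zx ZE // mulr_le0_ge0 ?subr_le0 ?Wmax //.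
  by rewrite exprn_ge0 // ltW // u_gt0.
have [pZ lZ] := local_max_laplacian D_open g_sym g_posdef sZ Dx Zmax.
have dux : differentiable u x by exact: (smooth_diff u_smooth).
have dGx : differentiable (grad_sqnorm g u) x by exact: (smooth_diff sG).
have pG i : partial i (grad_sqnorm g u) x = F1 (u x) * partial i u x.
  have dFu : differentiable (fun y => F (u y)) x by exact: (smooth_diff sF).
  have dFc : differentiable (fun y => F (u y) - lambda / N) x by exact: (smooth_diff sF').
  have := pZ i; rewrite /Z partialD ?partialN //; last exact: differentiableN.
  rewrite partialD // partial_cst addr0 (partial_comp i (dF (u x)) dux).
  by move/eqP; rewrite subr_eq0 => /eqP.
have lG : laplacian g (grad_sqnorm g u) x <=
    F2 (u x) * grad_sqnorm g u x + F1 (u x) * laplacian g u x.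
  move: lZ; rewrite /Z (laplacianB D_open) //.
  rewrite (laplacianB D_open _ sF (smooth_cst D_open _)) //.
  rewrite (laplacian_comp D_open _ (fun y _ => dF (u y)) (dF1 (u x))) //.
  rewrite laplacian_cst subr0 subr_le0 [X in _ <= X -> _]addrC.
  exact.
have b := bochner D_open g_smooth g_sym g_posdef u_smooth Dx.
have gradG : \sum_a gradient g u a x * partial a (grad_sqnorm g u) x =
    F1 (u x) * grad_sqnorm g u x.
  rewrite grad_sqnormE mulr_sumr; apply: eq_bigr => a _.
  by rewrite pG mulrCA.
(* Hess u (grad u, .) is half of d|grad u|^2, which at the maximum is a multiple of du by [pG]. *)
have hessVV : \sum_j \sum_l hessian g u x j l * (gradient g u j x * gradient g u l x)
    = 2^-1 * (F1 (u x) * grad_sqnorm g u x).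
  rewrite -gradG mulr_sumr exchange_big /=; apply: eq_bigr => l _.
  rewrite (partial_grad_sqnorm D_open g_smooth g_sym g_posdef l u_smooth Dx).
  rewrite [RHS]mulrCA mulKf // mulr_sumr; apply: eq_bigr => j _.
  by rewrite mulrA mulrC.
have metVV : \sum_j \sum_l g x j l * (gradient g u j x * gradient g u l x)
    = grad_sqnorm g u x.
  rewrite grad_sqnormE; apply: eq_bigr => j _.
  rewrite -(gradient_lower g_posdef u j Dx) mulr_sumr; apply: eq_bigr => l _.
  by rewrite mulrCA.
have ricVV : \sum_j \sum_l ricci g x j l * (gradient g u j x * gradient g u l x)
    = mu * grad_sqnorm g u x + k / u x * (2^-1 * (F1 (u x) * grad_sqnorm g u x)).
  rewrite -{1}metVV -hessVV !mulr_sumr -big_split /=; apply: eq_bigr => j _.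
  rewrite !mulr_sumr -big_split /=; apply: eq_bigr => l _.
  have /matrixP/(_ j l) := u_qe Dx.
  rewrite !mxE => /eqP; rewrite subr_eq => /eqP ->.
  by rewrite mulrDl -(mulrA mu) -(mulrA (k / u x)).
(* This is [u_laplacian] differentiated along grad u. *)
have dL : u x * (\sum_l gradient g u l x * partial l (laplacian g u) x)
      + grad_sqnorm g u x * laplacian g u x
    = N * (F1 (u x) * grad_sqnorm g u x) - 2 * mu * u x * grad_sqnorm g u x.
  have dl l : u x * partial l (laplacian g u) x + laplacian g u x * partial l u x =
      N * partial l (grad_sqnorm g u) x - mu * (2 * u x * partial l u x).
    have /(eq_on_partial D_open l)/(_ x (mem_set Dx)) :=
      fun y (Dy : y \in D) => u_laplacian (set_mem Dy).
    have dLx := smooth_diff sL Dx.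
    have du2 : differentiable (fun y => u y ^+ 2) x by exact: (smooth_diff (su2 2)).
    have dc (a : R) : differentiable (fun=> a) x by exact: differentiable_cst.
    have dN : differentiable (fun y => N * grad_sqnorm g u y) x.
      exact: differentiableM.
    have dmu : differentiable (fun y => mu * u y ^+ 2) x by exact: differentiableM.
    rewrite partialM // => ->.
    rewrite partialD ?partialN //; [|exact: differentiableD|exact: differentiableN].
    rewrite partialD // (partialM _ (dc N) dGx) (partialM _ (dc mu) du2).
    rewrite !partial_cst add0r !mulr0 !addr0.
    have -> : partial l (fun y => u y ^+ 2) x = 2 * u x ^+ 1 * partial l u x.
      exact: partial_comp (dX 1%N (u x)) dux.
    by [].
  pose V l := gradient g u l x.
  have /(congr1 (fun f => \sum_l V l * f l)) := funext dl.
  rewrite (eq_bigr (fun l => u x * (V l * partial l (laplacian g u) x) +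
    laplacian g u x * (V l * partial l u x))); last by move=> l _; ring.
  rewrite [X in _ = X -> _](eq_bigr (fun l => N * (V l * partial l (grad_sqnorm g u) x) -
    2 * mu * u x * (V l * partial l u x))); last by move=> l _; ring.
  rewrite sumrB big_split /= -!mulr_sumr gradG -grad_sqnormE => <-.
  by rewrite [X in _ + X]mulrC.
have [sV pV] := posdef_invmx (g_sym Dx) (g_posdef Dx).
have cs := sqr_trace_posdef_le sV pV (hessian_sym D_open g_sym u_smooth Dx).
have trL : \tr (invmx (g x) *m hessian g u x) = laplacian g u x.
  rewrite (laplacianE D_open) // -(@hessian1E _ _ D) //.
  by apply: eq_bigr => i _; rewrite mxE.
rewrite trL in cs.
have ux := u_gt0 Dx.
have nR : 0 < n%:R :> R by rewrite ltr0n.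
have F1E : F1 (u x) = u x * (2 * W x - (p%:R + 2) * (eps * u x ^+ p)).
  by rewrite /F1 -(natrD _ p 2) addn2 exprS; move: (W x) => w; ring.
have F2E : F2 (u x) = 2 * W x - (p%:R + 2) * (p%:R + 1) * (eps * u x ^+ p).
  rewrite /F2 -(natrD _ p 2) addn2 natr1; move: (W x) => w; ring.
apply: (@critical_point_contradiction R m mu lambda n%:R (u x) (laplacian g u x)
  (grad_sqnorm g u x) (laplacian g (grad_sqnorm g u) x)
  (\sum_l gradient g u l x * partial l (laplacian g u) x) _ (W x)
  (eps * u x ^+ p) p%:R) cs => //.
- exact: (grad_sqnorm_ge0 g_sym g_posdef).
- by rewrite mulr_gt0 ?exprn_gt0.
- by rewrite /W addrK divfK // expf_neq0 // lt0r_neq0.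
- exact: u_laplacian.
- by rewrite -F1E -F2E.
- by rewrite b ricVV -F1E.
- by rewrite dL F1E.
Qed.

End LocalContradiction.

(** * From charts to the manifold *)

Section ChartInvariance.
Variables (R : realType) (n : nat) (M : riemannian_manifold R n).
Implicit Types (c : chart M) (p : M) (w : M -> R).

Lemma metric_posdefP c p : chart_dom c p -> posdef (metric c (to_coord c p)).
Proof. by move=> cp v; exact: metric_posdef. Qed.

Lemma near_chart c c' p : chart_dom c p -> chart_dom c' p ->
  \forall y \near to_coord c p, chart_dom c' (of_coord c y).
Proof.
move=> cp c'p; have cv : of_coord c @ to_coord c p --> of_coord c (to_coord c p).
  exact: param_continuous.
rewrite coordK // in cv; apply: (cv (chart_dom c')).
by apply: open_nbhs_nbhs; split => //; exact: dom_open.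
Qed.

Lemma differentiable_transition c c' p : chart_dom c p -> chart_dom c' p ->
  differentiable (to_coord c' \o of_coord c) (to_coord c p).
Proof.
move=> cp c'p; set x := to_coord c p.
have -> : to_coord c' \o of_coord c =
    \sum_(i < n) (fun y => to_coord c' (of_coord c y) 0 i *: (delta_mx 0 i : 'rV[R]_n)).
  apply/funext => y; rewrite fct_sumE /= {1}(row_sum_delta (to_coord c' _)).
  by [].
apply: differentiable_sum => i; apply: differentiableZl.
by apply: (@transition_smooth _ _ M c c' i [::]); exists p.
Qed.

Lemma continuous_chart w (f : 'rV[R]_n -> R) c p : chart_dom c p ->
  differentiable f (to_coord c p) ->
  (forall q, chart_dom c q -> f (to_coord c q) = w q) -> {for p, continuous w}.
Proof.
move=> cp df wE.
have cc : to_coord c @ p --> to_coord c p by exact: Defs.coord_continuous.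
have cf : f @ to_coord c p --> f (to_coord c p).
  exact: differentiable_continuous.
have cw : (f \o to_coord c) @ p --> f (to_coord c p).
  by move=> A fA; exact: cc _ (cf A fA).
have nE : \forall q \near p, f (to_coord c q) = w q.
  by apply: filterS (open_nbhs_nbhs (conj (dom_open c) cp)) => q; exact: wE.
rewrite /prop_for /continuous_at -(wE p cp).
by apply: cvg_trans cw; exact: near_eq_cvg.
Qed.

(** The function to be maximized must live on all of M, so |grad w|^2 has to be independent of the
    chart; the other quantities are only computed in one chart around the maximum. Differentials
    transform by [J] and the metric by [J] on both sides, so [J], invertible because the metric is,
    cancels. *)
Lemma grad_sqnorm_chart w c c' p : smooth_fun w -> chart_dom c p -> chart_dom c' p ->
  grad_sqnorm (metric c) (local_expr w c) (to_coord c p) =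
  grad_sqnorm (metric c') (local_expr w c') (to_coord c' p).
Proof.
move=> sw cp c'p; set x := to_coord c p; set x' := to_coord c' p.
pose tau := to_coord c' \o of_coord c.
have dtau : differentiable tau x by exact: differentiable_transition.
have taux : tau x = x' by rewrite /tau /= coordK.
have dw' : differentiable (local_expr w c') x'.
  by apply: (sw c' [::]); exists p.
have wE : \forall y \near x, local_expr w c y = (local_expr w c' \o tau) y.
  by apply: filterS (near_chart cp c'p) => y cy; rewrite /tau /local_expr /= coordK.
pose J := jacobian tau x.
pose b := \col_i partial i (local_expr w c) x.
pose b' := \col_i partial i (local_expr w c') x'.
have bE : b = J *m b'.
  apply/matrixP => i j; rewrite !mxE /partial (near_eq_derive _ wE).
  have dw'' : differentiable (local_expr w c') (tau x) by rewrite taux.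
  rewrite deriveE; last exact: differentiable_comp.
  rewrite diff_comp //= -deriveE // derive_partial // taux.
  by apply: eq_bigr => l _; rewrite !mxE.
have gE : metric c x = J *m metric c' x' *m J^T by exact: metric_change.
have ug := posdef_unitmx (metric_posdefP cp).
have ug' := posdef_unitmx (metric_posdefP c'p).
have uJ : J \in unitmx.
  by move: ug; rewrite -/x gE !unitmx_mul => /andP[/andP[]].
have sqE (h : 'M[R]_n) (a : 'cV[R]_n) :
    \sum_i \sum_j h i j * (a i 0 * a j 0) = (a^T *m h *m a) 0 0.
  rewrite mxE exchange_big; apply: eq_bigr => j _ /=.
  rewrite !mxE mulr_suml; apply: eq_bigr => i _; rewrite !mxE.
  by rewrite mulrA [_ * a i 0]mulrC.
have GE c0 y (a := \col_i partial i (local_expr w c0) y) :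
    grad_sqnorm (metric c0) (local_expr w c0) y =
    (a^T *m invmx (metric c0 y) *m a) 0 0.
  rewrite -sqE; apply: eq_bigr => i _; apply: eq_bigr => j _.
  by rewrite !mxE.
rewrite !GE -/b -/b' bE gE; congr (fun_of_matrix _ 0 0).
have VE : J^T *m invmx (J *m metric c' x' *m J^T) *m J = invmx (metric c' x').
  rewrite -[LHS](mulKmx ug'); set X := invmx (J *m _ *m _).
  have /mulmx1C e : J *m (metric c' x' *m J^T *m X) = 1%:M.
    by rewrite !mulmxA mulmxV // -gE.
  by rewrite -[RHS]mulmx1 -e !mulmxA.
by rewrite -VE trmx_mul !mulmxA.
Qed.

End ChartInvariance.

(** * The elliptic equation satisfied by the weight *)

Section QuasiEinstein.
Variables (R : realType) (n : nat) (k : R) (X : smms n k) (mu lambda : R).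
Implicit Types (c : chart X) (p : X).

(** Trace of the quasi-Einstein equation. *)
Lemma weight_quasi_einstein c p : quasi_einstein X mu -> chart_dom c p ->
  let u := local_expr (weight X) c in let x := to_coord c p in
  scalar_curv (metric c) x = mu * n%:R + k / u x * laplacian (metric c) u x.
Proof.
move=> qe cp u x; have := qe c p cp; rewrite /bakry_emery_ricci -/x.
have -> : weight X p = u x by rewrite /u /local_expr /x /= coordK.
move=> ricE; pose g := metric c x.
have trg : \sum_i \sum_j invmx g i j * g i j = n%:R.
  have -> : n%:R = \sum_(i < n) 1 :> R by rewrite sumr_const card_ord.
  apply: eq_bigr => i _.
  have ug := posdef_unitmx (metric_posdefP cp).
  have /matrixP/(_ i i) := mulVmx ug; rewrite !mxE eqxx => /(etrans _); apply.
  apply: eq_bigr => j _; congr (_ * _).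
  by rewrite /g -{1}(Defs.metric_sym cp) mxE.
rewrite /scalar_curv /laplacian /metric_trace -trg !mulr_sumr -big_split /=.
apply: eq_bigr => i _; rewrite !mulr_sumr -big_split /=; apply: eq_bigr => j _.
have /matrixP/(_ i j) := ricE.
rewrite mxE [X in _ + X]mxE [X in _ - X]mxE [X in _ = X]mxE.
move=> /eqP; rewrite subr_eq => /eqP ->.
by rewrite mulrDr mulrCA [X in _ + X]mulrCA.
Qed.

(** Put phi = - k ln u and the traced quasi-Einstein equation into the definition of the
    characteristic constant. For k = 2 - m - n the coefficient 1 - k is m + n - 1. *)
Lemma weight_laplacian c p : quasi_einstein X mu -> characteristic_constant X mu lambda ->
  chart_dom c p ->
  let u := local_expr (weight X) c in let x := to_coord c p in
  u x * laplacian (metric c) u x =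
  lambda + (1 - k) * grad_sqnorm (metric c) u x - mu * u x ^+ 2.
Proof.
move=> qe cc cp u x; have := cc c p cp.
rewrite /weighted_scalar_curv (weight_quasi_einstein qe cp) -/u -/x.
have -> : weight X p = u x by rewrite /u /local_expr /x /= coordK.
have u_gt0 y : 0 < u y by exact: weight_gt0.
pose F (t : R) := - k * ln t.
pose F1 (t : R) := - k * t^-1.
have dF (t : R) : 0 < t -> is_derive t (1 : R) F (F1 t).
  move=> t0; have h := is_derive1_ln t0.
  exact: (is_deriveZ (- k) h).
have dF1 (t : R) : 0 < t -> is_derive t (1 : R) F1 (k / t ^+ 2).
  move=> t0; have tn := lt0r_neq0 t0.
  have h := is_deriveZ (- k) (@is_deriveV R id t 1 1 tn (is_derive_id t 1)).
  by apply: is_derive_eq h _; rewrite /GRing.scale /= mulr1 mulrN mulNr opprK.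
have -> : local_expr (phi (X := X)) c = fun y => F (u y).
  by apply/funext => y; rewrite /local_expr /phi /= ln_powR /F mulNr.
pose D := to_coord c @` chart_dom c.
have D_open : open D by exact: coord_open.
have su : smooth_on D u by exact: weight_smooth.
have Dx : D x by exists p.
rewrite (laplacian_comp D_open _ (fun y _ => dF _ (u_gt0 y)) (dF1 _ (u_gt0 x)) su Dx).
rewrite (grad_sqnorm_comp _ (dF _ (u_gt0 x)) (smooth_diff su Dx)) /F1.
have ux := lt0r_neq0 (u_gt0 x); have k0 := smms_dim_neq0 X.
move: (laplacian _ _ _) (grad_sqnorm _ _ _) => L G ccE.
(* Multiplied by k / u^2, the goal is [ccE] up to sign. *)
apply: (mulfI k0); apply: (mulfI (invr_neq0 ux)); apply: (mulfI (invr_neq0 ux)).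
apply/eqP; rewrite -subr_eq0; apply/eqP.
move/eqP: ccE; rewrite -subr_eq0 => /eqP ccE.
apply: etrans (_ : - (0 : R) = 0); last by rewrite oppr0.
rewrite -ccE; field.
by rewrite k0 ux.
Qed.

End QuasiEinstein.

(** * The compactness argument *)

Unset Implicit Arguments.
Set Strict Implicit.

Theorem corollary4p27 (R : realType) (n : nat) (n_gt0 : (0 < n)%N)
    (m : R) (m_gt1 : 1 < m)
    (X : smms n (2 - m - n%:R)) (X_compact : compact [set: X])
    (mu lambda : R) (mu_gt0 : 0 < mu)
    (X_qe : quasi_einstein X mu)
    (X_cc : characteristic_constant X mu lambda)
    (c : chart X) (p : X) (cp : chart_dom c p) :
  grad_sqnorm (metric c) (local_expr (weight X) c) (to_coord c p)
    + lambda / (m + n%:R - 1)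
  < mu / (m - 1) * weight X p ^+ 2.
Proof.
rewrite ltNge; apply/negP => Fp.
set N := m + n%:R - 1 in Fp; set w := weight X.
have n0 : 0 < n%:R :> R by rewrite ltr0n.
have n1 : 1 <= n%:R :> R by rewrite ler1n.
have N0 : 0 < N by rewrite /N; lra.
have w0 q : 0 < w q by exact: weight_gt0.
have sw : smooth_fun w by exact: weight_smooth.
have b0 : 0 < mu / (m - 1) by rewrite divr_gt0 // subr_gt0.
have wE c' q : chart_dom c' q -> local_expr w c' (to_coord c' q) = w q.
  by move=> c'q; rewrite /local_expr /= coordK.
have in_coord (c' : chart X) q : chart_dom c' q -> (to_coord c' @` chart_dom c') (to_coord c' q).
  by move=> c'q; exists q.
have gsm c' := @metric_smooth _ _ X c'.
have gpd (c' : chart X) y : (to_coord c' @` chart_dom c') y -> posdef (metric c' y).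
  by move=> [q c'q <-]; exact: metric_posdefP.
have gsy (c' : chart X) y : (to_coord c' @` chart_dom c') y -> (metric c' y)^T = metric c' y.
  by move=> [q c'q <-]; exact: Defs.metric_sym.
have [q0 _ wmax] : exists2 q, q \in [set: X] & forall q', q' \in [set: X] -> w q' <= w q.
  apply: compact_EVT_max X_compact _; first by exists p.
  apply: continuous_subspaceT => q; have [c' c'q] := dom_cover q.
  apply: (continuous_chart c'q); last exact: wE.
  by apply: smooth_diff (sw c') _; exact: in_coord.
(* Large enough for both lower bounds on the exponent in [no_local_max]; the bound by n P also uses
   1 <= n. *)
pose P := Num.bound (2 * (m - 1) + N).
have P_gt : 2 * (m - 1) + N < P%:R.
  by apply: archi_boundP; rewrite addr_ge0 ?(ltW N0) // mulr_ge0 // subr_ge0 ltW.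
(* The maximum point of [W] depends on [eps], so the smallness must hold uniformly on M: dividing by
   the maximum of w^P gives N eps w^P <= n mu / (2 (m-1)) everywhere, and the factor 2 makes the
   required bound strict. *)
pose eps := n%:R * (mu / (m - 1)) / (2 * N * w q0 ^+ P).
have eps0 : 0 < eps.
  apply: divr_gt0; first exact: mulr_gt0.
  by apply: mulr_gt0; [exact: mulr_gt0|exact: exprn_gt0].
pose Gc c' y := grad_sqnorm (metric c') (local_expr w c') y.
pose Wc c' y := (Gc c' y + lambda / N) / local_expr w c' y ^+ 2 +
  eps * local_expr w c' y ^+ P.
(* An arbitrary chart is chosen at each point; [WE] shows that the value does not depend on it. *)
pose W (q : X) := Wc (projT1 (cid (dom_cover q))) (to_coord (projT1 (cid (dom_cover q))) q).
have WE c' q : chart_dom c' q -> Wc c' (to_coord c' q) = W q.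
  move=> c'q; rewrite /W; case: (cid (dom_cover q)) => c'' /= c''q.
  by rewrite /Wc !wE // /Gc (grad_sqnorm_chart sw c'q c''q).
have [q1 _ Wmax] : exists2 q, q \in [set: X] & forall q', q' \in [set: X] -> W q' <= W q.
  apply: compact_EVT_max X_compact _; first by exists p.
  apply: continuous_subspaceT => q; have [c' c'q] := dom_cover q.
  apply: (continuous_chart c'q); last exact: WE.
  have oD := @coord_open _ _ X c'.
  have sG := smooth_grad_sqnorm oD (gsm c') (@gpd c') (sw c').
  apply: (smooth_diff _ (in_coord _ _ c'q)).
  apply: smoothD => //.
    apply: smoothM => //; first by apply: smoothD => //; exact: smooth_cst.
    apply: smoothV => //; last by apply: smoothX.
    by move=> y _; rewrite expf_neq0 // lt0r_neq0 // /local_expr /= w0.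
  by apply: smoothM => //; [exact: smooth_cst|exact: smoothX].
have Wp : mu / (m - 1) < W q1.
  apply: lt_le_trans (Wmax p _); last by rewrite inE.
  rewrite -(WE c p cp) /Wc wE //.
  apply: (@le_lt_trans _ _ ((Gc c (to_coord c p) + lambda / N) / w p ^+ 2)).
    by rewrite ler_pdivlMr // exprn_gt0.
  by rewrite ltrDl mulr_gt0 // exprn_gt0.
have [c1 c1q] := dom_cover q1.
apply: (@no_local_max R n _ (@coord_open _ _ X c1) (metric c1) (gsm c1) (@gsy c1) (@gpd c1)
  m mu lambda (local_expr w c1) (sw c1) _ _ _ eps P (to_coord c1 q1)) => //.
- by move=> y [q _ <-]; exact: w0.
- move=> y [q c1q' <-]; rewrite wE //.
  by have := X_qe c1 q c1q'; rewrite /bakry_emery_ricci.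
- move=> y [q c1q' <-]; have -> : m + n%:R - 1 = 1 - (2 - m - n%:R) by ring.
  exact: weight_laplacian X_qe X_cc c1q'.
- by rewrite -/N; apply: ltW; apply: le_lt_trans P_gt; rewrite lerDr mulr_ge0 // subr_ge0 ltW.
- apply: (@le_trans _ _ P%:R); last by rewrite ler_peMl.
  by apply: ltW; apply: le_lt_trans P_gt; rewrite lerDl ltW.
- rewrite -/N wE //.
  have wq : w q1 ^+ P <= w q0 ^+ P.
    apply: lerXn2r; [by rewrite nnegrE ltW|by rewrite nnegrE ltW|].
    by apply: wmax; rewrite inE.
  have wq0 : 0 < w q0 ^+ P by exact: exprn_gt0.
  have nb : 0 < n%:R * (mu / (m - 1)) by exact: mulr_gt0.
  have eE : N * (eps * w q0 ^+ P) = n%:R * (mu / (m - 1)) / 2.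
    by rewrite /eps; move: (mu / _) (w q0 ^+ P) wq0 => b v v0; field; rewrite !lt0r_neq0.
  apply: (@le_lt_trans _ _ (N * (eps * w q0 ^+ P))).
    by rewrite !ler_pM2l.
  by rewrite eE ltr_pdivrMr // ltr_pMr // ltr1n.
- have := Wp; rewrite -(WE c1 q1 c1q); exact.
- move=> y [q c1q' <-]; have := Wmax q; rewrite inE => /(_ I).
  rewrite -(WE c1 q c1q') -(WE c1 q1 c1q); exact.
Qed.
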